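(* Let $\mathbb{D}=\{\xi\in\mathbb{C}:|\xi|<1\}$, let $K\subset\mathbb{D}$ be a nonempty removable set, and let $\Omega=\mathbb{D}\setminus K$ be an open connected set. Then the squeezing function on $\Omega$ is given, for every $z\in\Omega$, by $$S_{\Omega}(z)=\min_{w\in K}\left|\frac{w-z}{1-\overline{z}w}\right|.$$
   Context: A compact set $K\subset\mathbb{C}$ is called removable (for bounded holomorphic functions) if for every open set $U\supseteq K$ in $\mathbb{C}$, each bounded holomorphic function on $U\setminus K$ extends holomorphically to all of $U$. For a bounded domain $G\subseteq\mathbb{C}$, $z\in G$, and an injective holomorphic map $f:G\to\mathbb{D}$ with $f(z)=0$, let $$S_G(z,f)=\sup\{r : \mathbb{D}(0,r)\subseteq f(G)\},$$ where $\mathbb{D}(0,r)$ is the Euclidean disc of radius $r$ centred at the origin. The squeezing function of $G$ is $S_G(z)=\sup_f S_G(z,f)$, the supremum over all injective holomorphic $f:G\to\mathbb{D}$ with $f(z)=0$. *)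

(* Defs.v *)
From Stdlib Require Import Reals List.
From Coquelicot Require Import Coquelicot.
Local Open Scope C_scope.

Definition open_disc (r : R) (z : C) : Prop := (Cmod z < r)%R.

Definition setdiff (A B : C -> Prop) (z : C) : Prop := A z /\ ~ B z.

Definition compact_set (K : C -> Prop) : Prop :=
  forall (I : Type) (V : I -> C -> Prop),
    (forall i, open (V i)) ->
    (forall z, K z -> exists i, V i z) ->
    exists l : list I, forall z, K z -> exists i, In i l /\ V i z.

(* No two open sets of the plane cut [G] into two nonempty relatively open
   pieces. *)
Definition connected_set (G : C -> Prop) : Prop :=
  forall A B : C -> Prop,
    open A -> open B ->
    (forall z, G z -> A z \/ B z) ->
    (exists z, G z /\ A z) ->
    (exists z, G z /\ B z) ->
    exists z, G z /\ A z /\ B z.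

(* Functions on a subset of the plane are total functions whose values outside
   the subset are irrelevant. [ex_derive] over [C_AbsRing] is complex
   differentiability and inspects a full neighbourhood of the point, so [G] is
   meant to be open. *)
Definition holomorphic_on (G : C -> Prop) (f : C -> C) : Prop :=
  forall z, G z -> @ex_derive C_AbsRing C_NormedModule f z.

Definition bounded_on (G : C -> Prop) (f : C -> C) : Prop :=
  exists M : R, forall z, G z -> (Cmod (f z) <= M)%R.

Definition injective_on (G : C -> Prop) (f : C -> C) : Prop :=
  forall x y, G x -> G y -> f x = f y -> x = y.

Definition removable (K : C -> Prop) : Prop :=
  compact_set K /\
  forall U : C -> Prop,
    open U -> (forall z, K z -> U z) ->
    forall f : C -> C,
      holomorphic_on (setdiff U K) f -> bounded_on (setdiff U K) f ->
      exists g : C -> C,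
        holomorphic_on U g /\ forall z, setdiff U K z -> g z = f z.

Definition disc_embedding (G : C -> Prop) (z : C) (f : C -> C) : Prop :=
  holomorphic_on G f /\ injective_on G f /\
  (forall x, G x -> open_disc 1 (f x)) /\ f z = 0.

Definition image_of (G : C -> Prop) (f : C -> C) (y : C) : Prop :=
  exists x, G x /\ f x = y.

Definition squeezing_at (G : C -> Prop) (f : C -> C) : Rbar :=
  Lub_Rbar (fun r : R =>
    (0 < r)%R /\ forall y, open_disc r y -> image_of G f y).

Definition squeezing (G : C -> Prop) (z : C) : Rbar :=
  Rbar_lub (fun s : Rbar =>
    exists f : C -> C, disc_embedding G z f /\ s = squeezing_at G f).

Definition is_min_over (K : C -> Prop) (h : C -> R) (m : R) : Prop :=
  (exists w, K w /\ h w = m) /\ forall w, K w -> (m <= h w)%R.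

(* Main.v *)
Require Import Defs.
From Stdlib Require Import Reals Lra Psatz List Classical ClassicalEpsilon.
From Coquelicot Require Import Coquelicot.

(* The Moebius map sending [z] to 0 embeds the domain onto the disc minus the
   image of [K], whose largest centred disc has radius the minimum of
   [|moebius z w|] over [K]. Conversely, an embedding [f] with [f z = 0] extends
   to [g] on the whole disc; by Schwarz, [|g w| <= |moebius z w|], while the value
   [g w] at a point [w] of [K] is not taken by [f], because [K] has empty interior
   and [f] is open and injective. So no disc of radius larger than
   [|moebius z w|] lies in the image of [f]. The complex analysis needed reduces
   to the maximum principle, which comes from the mean value property and
   Goursat's theorem. *)

(** * Complex differentiability *)

Local Open Scope C_scope.

(** Differentiability is used only pointwise: no Cauchy formula, power series or continuity of the
    derivative is developed. The obstacle is the Schwarz quotient [g x / (x - z)], which is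
    differentiable off [z] but, from the definition, merely continuous at [z]. The maximum principle
    therefore admits one exceptional point [q] at which continuity is enough, and the mean value
    property asks no more than continuity at its centre. Carathéodory's form supplies that
    continuous quotient directly. A real-part mean value suffices, because a unimodular factor turns
    the value of interest into its modulus. So only the imaginary part of the rectangle integral is
    kept: on vertical sides dw = i dt, and Im(F dw) is Re F dt. The extension [g] comes with no
    bound on [K] and no injectivity. Schwarz thus relies on a bound near the unit circle alone, and
    the avoidance of values on the injectivity of [f] off [K]. *)

Definition ccont (F : C -> C) (p : C) : Prop :=
  forall eps, (0 < eps)%R -> exists d, (0 < d)%R /\
    forall x, (Cmod (x - p) < d)%R -> (Cmod (F x - F p) < eps)%R.

(* Caratheodory's form of complex differentiability. *)
Definition cdiff (F : C -> C) (p : C) : Prop :=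
  exists phi, ccont phi p /\
    exists d, (0 < d)%R /\
      forall x, (Cmod (x - p) < d)%R -> F x = F p + phi x * (x - p).

Lemma Cmod_sub_sym (x y : C) : Cmod (x - y) = Cmod (y - x).
Proof. rewrite <- Cmod_opp. f_equal. ring. Qed.

Lemma Cmod_sub_triangle (x y z : C) : (Cmod (x - z) <= Cmod (x - y) + Cmod (y - z))%R.
Proof. replace (x - z) with ((x - y) + (y - z)) by ring. apply Cmod_triangle. Qed.

Lemma Cmod_self (x : C) : Cmod (x - x) = 0%R.
Proof. replace (x - x) with (RtoC 0) by ring. apply Cmod_0. Qed.

Lemma Csub_neq (x y : C) : x <> y -> x - y <> 0.
Proof. intros H E. apply H. replace x with (x - y + y) by ring. rewrite E. ring. Qed.

Lemma Cmod_sub_pos (x y : C) : x <> y -> (0 < Cmod (x - y))%R.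
Proof. intros H. apply Cmod_gt_0. now apply Csub_neq. Qed.

Lemma Cmod_sub_lower (x y : C) : (Cmod x - Cmod (x - y) <= Cmod y)%R.
Proof.
generalize (Cmod_triangle y (x - y)). replace (y + (x - y)) with x by ring. lra.
Qed.

Lemma ccont_local (F G : C -> C) (p : C) (d : R) :
  (0 < d)%R -> (forall x, (Cmod (x - p) < d)%R -> F x = G x) -> ccont F p -> ccont G p.
Proof.
intros Hd E H e He. destruct (H e He) as [d' [Hd' H']].
exists (Rmin d d'). split. now apply Rmin_pos.
intros x Hx. rewrite <- !E.
- apply H'. eapply Rlt_le_trans. exact Hx. apply Rmin_r.
- rewrite Cmod_self; lra.
- eapply Rlt_le_trans. exact Hx. apply Rmin_l.
Qed.

Lemma ccont_const (c p : C) : ccont (fun _ => c) p.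
Proof. intros e He. exists 1%R. split. lra. intros. rewrite Cmod_self. lra. Qed.

Lemma ccont_id (p : C) : ccont (fun x => x) p.
Proof. intros e He. exists e. now split. Qed.

Lemma ccont_plus (F G : C -> C) (p : C) :
  ccont F p -> ccont G p -> ccont (fun x => F x + G x) p.
Proof.
intros HF HG e He.
destruct (HF (e/2)%R) as [d1 [Hd1 H1]]. lra.
destruct (HG (e/2)%R) as [d2 [Hd2 H2]]. lra.
exists (Rmin d1 d2). split. now apply Rmin_pos.
intros x Hx.
assert (A1 := H1 x (Rlt_le_trans _ _ _ Hx (Rmin_l _ _))).
assert (A2 := H2 x (Rlt_le_trans _ _ _ Hx (Rmin_r _ _))).
replace (F x + G x - (F p + G p)) with ((F x - F p) + (G x - G p)) by ring.
eapply Rle_lt_trans. apply Cmod_triangle. lra.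
Qed.

Lemma ccont_mult (F G : C -> C) (p : C) :
  ccont F p -> ccont G p -> ccont (fun x => F x * G x) p.
Proof.
intros HF HG e He.
assert (P1 := Cmod_ge_0 (F p)). assert (P2 := Cmod_ge_0 (G p)).
set (m := (Cmod (F p) + Cmod (G p) + 1)%R). assert (Hm : (1 <= m)%R) by (unfold m; lra).
(* With both increments below [e'] and [e' <= 1], the three error terms add up to at most [e' * m],
   hence at most [e / 2]. *)
set (e' := Rmin 1 (e / (2 * m))).
assert (He' : (0 < e')%R).
{ apply Rmin_pos. lra. apply Rdiv_lt_0_compat; lra. }
destruct (HF e' He') as [d1 [Hd1 H1]]. destruct (HG e' He') as [d2 [Hd2 H2]].
exists (Rmin d1 d2). split. now apply Rmin_pos.
intros x Hx.
assert (A1 := H1 x (Rlt_le_trans _ _ _ Hx (Rmin_l _ _))).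
assert (A2 := H2 x (Rlt_le_trans _ _ _ Hx (Rmin_r _ _))).
replace (F x * G x - F p * G p) with
  ((F x - F p) * (G x - G p) + ((F x - F p) * G p + F p * (G x - G p))) by ring.
eapply Rle_lt_trans. apply Cmod_triangle.
eapply Rle_lt_trans. apply Rplus_le_compat_l. apply Cmod_triangle.
rewrite !Cmod_mult.
assert (B1 : (e' <= 1)%R) by apply Rmin_l.
assert (B2 : (e' * m < e)%R).
{ assert (e' <= e / (2*m))%R by apply Rmin_r.
  apply Rle_lt_trans with (e / (2*m) * m)%R.
  apply Rmult_le_compat_r; lra. replace (e / (2*m) * m)%R with (e/2)%R by (field; lra). lra. }
assert (Q1 := Cmod_ge_0 (F x - F p)). assert (Q2 := Cmod_ge_0 (G x - G p)).
unfold m in B2. nra.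
Qed.

Lemma ccont_inv (F : C -> C) (p : C) :
  F p <> 0 -> ccont F p -> ccont (fun x => / F x) p.
Proof.
intros Hp HF e He.
assert (P := proj1 (Cmod_gt_0 _) Hp). set (m := Cmod (F p)) in *.
(* The bound [m / 2] keeps [Cmod (F x)] above [m / 2]; the other one then absorbs the denominator
   [Cmod (F x) * m]. *)
destruct (HF (Rmin (m/2) (e * m * m / 2))%R) as [d [Hd H]].
{ apply Rmin_pos. lra. apply Rmult_lt_0_compat; try lra. repeat apply Rmult_lt_0_compat; lra. }
exists d. split. exact Hd. intros x Hx. assert (A := H x Hx).
assert (A1 := Rlt_le_trans _ _ _ A (Rmin_l _ _)).
assert (A2 := Rlt_le_trans _ _ _ A (Rmin_r _ _)).
assert (B := Cmod_sub_lower (F p) (F x)). rewrite Cmod_sub_sym in B. fold m in B.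
assert (Hx0 : F x <> 0). { apply Cmod_gt_0. lra. }
replace (/ F x - / F p) with (- (F x - F p) * / (F x * F p)) by (field; auto).
rewrite Cmod_mult, Cmod_opp, Cmod_inv, Cmod_mult by (apply Cmult_neq_0; auto).
fold m. apply Rmult_lt_reg_r with (Cmod (F x) * m)%R.
apply Rmult_lt_0_compat; lra.
rewrite Rmult_assoc, Rinv_l, Rmult_1_r.
2: apply Rgt_not_eq, Rmult_lt_0_compat; lra.
eapply Rlt_le_trans. exact A2.
assert (0 < e * m)%R by (apply Rmult_lt_0_compat; lra).
nra.
Qed.

Lemma ccont_comp (F G : C -> C) (p : C) :
  ccont G p -> ccont F (G p) -> ccont (fun x => F (G x)) p.
Proof.
intros HG HF e He. destruct (HF e He) as [d [Hd H]]. destruct (HG d Hd) as [d' [Hd' H']].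
exists d'. split. auto. intros x Hx. apply H, H', Hx.
Qed.

Lemma cdiff_ccont (F : C -> C) (p : C) : cdiff F p -> ccont F p.
Proof.
intros [phi [Hphi [d [Hd E]]]].
apply ccont_local with (fun x => F p + phi x * (x - p)) d; auto.
- intros; symmetry; auto.
- apply ccont_plus. apply ccont_const. apply ccont_mult. exact Hphi.
  apply ccont_plus. apply ccont_id. apply ccont_const.
Qed.

Lemma cdiff_local (F G : C -> C) (p : C) (d : R) :
  (0 < d)%R -> (forall x, (Cmod (x - p) < d)%R -> F x = G x) -> cdiff F p -> cdiff G p.
Proof.
intros Hd E [phi [Hphi [d' [Hd' E']]]]. exists phi. split; auto.
exists (Rmin d d'). split. now apply Rmin_pos.
intros x Hx. rewrite <- !E. apply E'.
- eapply Rlt_le_trans. exact Hx. apply Rmin_r.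
- rewrite Cmod_self; lra.
- eapply Rlt_le_trans. exact Hx. apply Rmin_l.
Qed.

Lemma cdiff_const (c p : C) : cdiff (fun _ => c) p.
Proof.
exists (fun _ => 0). split. apply ccont_const. exists 1%R. split. lra. intros; ring.
Qed.

Lemma cdiff_id (p : C) : cdiff (fun x => x) p.
Proof.
exists (fun _ => 1). split. apply ccont_const. exists 1%R. split. lra. intros; ring.
Qed.

Lemma cdiff_plus (F G : C -> C) (p : C) :
  cdiff F p -> cdiff G p -> cdiff (fun x => F x + G x) p.
Proof.
intros [f [Hf [d [Hd E]]]] [g [Hg [d' [Hd' E']]]].
exists (fun x => f x + g x). split. now apply ccont_plus.
exists (Rmin d d'). split. now apply Rmin_pos. intros x Hx.
rewrite E, E'. ring.
eapply Rlt_le_trans. exact Hx. apply Rmin_r.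
eapply Rlt_le_trans. exact Hx. apply Rmin_l.
Qed.

Lemma cdiff_mult (F G : C -> C) (p : C) :
  cdiff F p -> cdiff G p -> cdiff (fun x => F x * G x) p.
Proof.
intros HF HG. assert (CG := cdiff_ccont _ _ HG).
destruct HF as [f [Hf [d [Hd E]]]]; destruct HG as [g [Hg [d' [Hd' E']]]].
exists (fun x => f x * G x + F p * g x). split.
{ apply ccont_plus. now apply ccont_mult. apply ccont_mult. apply ccont_const. auto. }
exists (Rmin d d'). split. now apply Rmin_pos. intros x Hx.
rewrite E, E'. ring.
eapply Rlt_le_trans. exact Hx. apply Rmin_r.
eapply Rlt_le_trans. exact Hx. apply Rmin_l.
Qed.

Lemma cdiff_inv (F : C -> C) (p : C) :
  F p <> 0 -> cdiff F p -> cdiff (fun x => / F x) p.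
Proof.
intros Hp HF. assert (CF := cdiff_ccont _ _ HF).
destruct HF as [f [Hf [d [Hd E]]]].
destruct (CF (Cmod (F p)) (proj1 (Cmod_gt_0 _) Hp)) as [d' [Hd' Hn]].
assert (N : forall x, (Cmod (x - p) < d')%R -> F x <> 0).
{ intros x Hx E0. specialize (Hn x Hx). rewrite E0 in Hn.
  replace (0 - F p) with (- F p) in Hn by ring. rewrite Cmod_opp in Hn. lra. }
exists (fun x => - f x * / (F x * F p)). split.
{ apply ccont_mult. apply ccont_local with (fun x => (-(1)) * f x) 1%R.
  lra. intros; ring. apply ccont_mult. apply ccont_const. exact Hf.
  apply (ccont_inv (fun x => F x * F p)). now apply Cmult_neq_0.
  apply ccont_mult. exact CF. apply ccont_const. }
exists (Rmin d d'). split. now apply Rmin_pos. intros x Hx.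
assert (Fx : F x <> 0) by (apply N; eapply Rlt_le_trans; [exact Hx | apply Rmin_r]).
assert (Ex : F x = F p + f x * (x - p)).
{ apply E. eapply Rlt_le_trans. exact Hx. apply Rmin_l. }
transitivity (/ F p - (F x - F p) * / (F x * F p)). field; auto.
replace (F x - F p) with (f x * (x - p)). ring. rewrite Ex at 1. ring.
Qed.

Lemma cdiff_comp (F G : C -> C) (p : C) :
  cdiff G p -> cdiff F (G p) -> cdiff (fun x => F (G x)) p.
Proof.
intros HG. assert (CG := cdiff_ccont _ _ HG).
destruct HG as [g [Hg [d [Hd E]]]]; intros [f [Hf [d' [Hd' E']]]].
exists (fun x => f (G x) * g x). split.
{ apply ccont_mult. now apply ccont_comp. auto. }
destruct (CG d' Hd') as [d2 [Hd2 H2]].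
exists (Rmin d d2). split. now apply Rmin_pos. intros x Hx.
rewrite (E' (G x)). rewrite (E x) at 2. ring.
eapply Rlt_le_trans. exact Hx. apply Rmin_l.
apply H2. eapply Rlt_le_trans. exact Hx. apply Rmin_r.
Qed.

Lemma cdiff_opp (F : C -> C) (p : C) : cdiff F p -> cdiff (fun x => - F x) p.
Proof.
intros H. apply cdiff_local with (fun x => (-(1)) * F x) 1%R. lra. intros; ring.
apply cdiff_mult; auto. apply cdiff_const.
Qed.

Lemma cdiff_minus (F G : C -> C) (p : C) :
  cdiff F p -> cdiff G p -> cdiff (fun x => F x - G x) p.
Proof. intros HF HG. apply cdiff_plus. exact HF. now apply cdiff_opp. Qed.

Lemma cdiff_div (F G : C -> C) (p : C) :
  G p <> 0 -> cdiff F p -> cdiff G p -> cdiff (fun x => F x / G x) p.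
Proof. intros H0 HF HG. apply cdiff_mult. exact HF. now apply cdiff_inv. Qed.

Lemma locally_Cmod (P : C -> Prop) (p : C) :
  @locally (AbsRing_UniformSpace C_AbsRing) p P <->
  exists d, (0 < d)%R /\ forall x, (Cmod (x - p) < d)%R -> P x.
Proof.
split.
- intros [d H]. exists d. split. apply cond_pos. intros x Hx. apply H. exact Hx.
- intros [d [Hd H]]. exists (mkposreal d Hd). intros x Hx. apply H. exact Hx.
Qed.

(** On [C], [open] refers to the product structure of the plane, while complex derivatives use the
    balls of [C_AbsRing]. [locally_C] identifies the two, so everything can be phrased with
    [Cmod]. *)
Lemma open_Cmod (A : C -> Prop) :
  open A <-> forall z, A z -> exists d, (0 < d)%R /\ forall x, (Cmod (x - z) < d)%R -> A x.
Proof.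
split; intros H z Hz.
- apply locally_Cmod. apply locally_C. exact (H z Hz).
- apply locally_C. apply locally_Cmod. exact (H z Hz).
Qed.

Lemma ex_derive_cdiff (F : C -> C) (p : C) :
  @ex_derive C_AbsRing C_NormedModule F p <-> cdiff F p.
Proof.
split.
- intros [l [_ H]].
  specialize (H p (fun P HP => HP)).
  (* The difference quotient, completed at [p] by the derivative. Below, [e / 2] is used because the
     derivative gives a non-strict bound and [ccont] wants a strict one. *)
  exists (fun x => if excluded_middle_informative (x = p) then l else (F x - F p) / (x - p)).
  split.
  + intros e He. assert (He2 : (0 < e/2)%R) by lra.
    destruct (proj1 (locally_Cmod _ _) (H (mkposreal _ He2))) as [d [Hd Hl]].
    exists d. split. auto. intros x Hx. specialize (Hl x Hx).
    destruct (excluded_middle_informative (p = p)) as [_|N]; [|now elim N].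
    destruct (excluded_middle_informative (x = p)) as [Ex|N].
    rewrite Cmod_self; lra.
    change (Cmod ((F x - F p) - (x - p) * l) <= e / 2 * Cmod (x - p))%R in Hl.
    assert (P := Cmod_sub_pos _ _ N). assert (N' := Csub_neq _ _ N).
    apply Rle_lt_trans with (e/2)%R; try lra.
    apply Rmult_le_reg_r with (Cmod (x - p)); auto.
    rewrite <- Cmod_mult. eapply Rle_trans. 2: exact Hl.
    apply Req_le. f_equal. field. auto.
  + exists 1%R. split. lra. intros x _.
    destruct (excluded_middle_informative (x = p)) as [Ex|N].
    rewrite Ex; ring. field. now apply Csub_neq.
- intros [phi [Hphi [d [Hd E]]]]. exists (phi p).
  split.
  + apply is_linear_scal_l.
  + intros q Hq. assert (Eq := @is_filter_lim_locally_unique C_AbsRing (AbsRing_NormedModule C_AbsRing) p q Hq). subst q. intros e.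
    destruct (Hphi e (cond_pos e)) as [d' [Hd' Hl]].
    apply locally_Cmod. exists (Rmin d d'). split. now apply Rmin_pos.
    intros x Hx.
    change (Cmod ((F x - F p) - (x - p) * phi p) <= e * Cmod (x - p))%R.
    rewrite E. 2: eapply Rlt_le_trans; [exact Hx | apply Rmin_l].
    replace (F p + phi x * (x - p) - F p - (x - p) * phi p) with ((phi x - phi p) * (x - p)) by ring.
    rewrite Cmod_mult. apply Rmult_le_compat_r. apply Cmod_ge_0. left. apply Hl.
    eapply Rlt_le_trans; [exact Hx | apply Rmin_r].
Qed.

(** * Goursat's theorem on rectangles *)

Local Open Scope R_scope.

Lemma Cmod_le_Rabs (x y : R) : Cmod (x, y) <= Rabs x + Rabs y.
Proof.
replace ((x, y) : C) with (RtoC x + Ci * RtoC y)%C.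
2: unfold RtoC, Ci, Cmult, Cplus; simpl; f_equal; ring.
eapply Rle_trans. apply Cmod_triangle.
rewrite Cmod_mult, Cmod_Ci, !Cmod_R. lra.
Qed.

Lemma im_le_Cmod (c : C) : Rabs (Im c) <= Cmod c.
Proof. eapply Rle_trans. 2: apply Rmax_Cmod. apply Rmax_r. Qed.

(** [P] stands for [Re] or [Im], of which only the Lipschitz bound matters. *)
Lemma continuous_horizontal (F : C -> C) (x y : R) (P : C -> R) :
  (forall u v, Rabs (P u - P v) <= Cmod (u - v)) ->
  ccont F (x, y) -> continuous (fun t => P (F (t, y))) x.
Proof.
intros HP H. apply continuity_pt_filterlim. intros e He.
destruct (H e He) as [d [Hd Hl]]. exists d. split. exact Hd.
intros t [_ Ht]. simpl in *. unfold R_dist in *.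
eapply Rle_lt_trans. apply HP. apply Hl.
eapply Rle_lt_trans. 2: exact Ht.
replace ((t, y) - (x, y))%C with (RtoC (t - x)). rewrite Cmod_R. lra.
unfold Cminus, Cplus, Copp, RtoC; simpl. f_equal; ring.
Qed.

Lemma continuous_vertical (F : C -> C) (x y : R) (P : C -> R) :
  (forall u v, Rabs (P u - P v) <= Cmod (u - v)) ->
  ccont F (x, y) -> continuous (fun t => P (F (x, t))) y.
Proof.
intros HP H. apply continuity_pt_filterlim. intros e He.
destruct (H e He) as [d [Hd Hl]]. exists d. split. exact Hd.
intros t [_ Ht]. simpl in *. unfold R_dist in *.
eapply Rle_lt_trans. apply HP. apply Hl.
eapply Rle_lt_trans. 2: exact Ht.
eapply Rle_trans. apply (Cmod_le_Rabs (x - x) (t - y)).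
rewrite Rminus_diag, Rabs_R0. lra.
Qed.

Lemma Re_lip (u v : C) : Rabs (Re u - Re v) <= Cmod (u - v).
Proof. exact (re_le_Cmod (u - v)). Qed.

Lemma Im_lip (u v : C) : Rabs (Im u - Im v) <= Cmod (u - v).
Proof. exact (im_le_Cmod (u - v)). Qed.

(* The imaginary part of the integral of [F] along the boundary of
   [x0,x1] x [y0,y1]. *)
Definition rect_int (F : C -> C) (x0 x1 y0 y1 : R) : R :=
  RInt (fun t => Im (F (t, y0))) x0 x1 + RInt (fun t => Re (F (x1, t))) y0 y1
  - RInt (fun t => Im (F (t, y1))) x0 x1 - RInt (fun t => Re (F (x0, t))) y0 y1.

Definition rect (x0 x1 y0 y1 : R) (z : C) : Prop :=
  x0 <= fst z <= x1 /\ y0 <= snd z <= y1.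

Lemma ex_RInt_horizontal (F : C -> C) (P : C -> R) (x0 x1 y : R) :
  (forall u v, Rabs (P u - P v) <= Cmod (u - v)) -> x0 <= x1 ->
  (forall t, x0 <= t <= x1 -> ccont F (t, y)) ->
  ex_RInt (fun t => P (F (t, y))) x0 x1.
Proof.
intros HP Hx H. apply (ex_RInt_continuous (V := R_CompleteNormedModule)). intros t Ht.
rewrite Rmin_left, Rmax_right in Ht by lra. apply continuous_horizontal; auto.
Qed.

Lemma ex_RInt_vertical (F : C -> C) (P : C -> R) (x y0 y1 : R) :
  (forall u v, Rabs (P u - P v) <= Cmod (u - v)) -> y0 <= y1 ->
  (forall t, y0 <= t <= y1 -> ccont F (x, t)) ->
  ex_RInt (fun t => P (F (x, t))) y0 y1.
Proof.
intros HP Hx H. apply (ex_RInt_continuous (V := R_CompleteNormedModule)). intros t Ht.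
rewrite Rmin_left, Rmax_right in Ht by lra. apply continuous_vertical; auto.
Qed.

(** Each inner side bounds two of the quarters, with opposite orientations, and cancels; the outer
    sides are joined by Chasles. Continuity is there for integrability. *)
Lemma rect_int_split (F : C -> C) (x0 xm x1 y0 ym y1 : R) :
  x0 <= xm <= x1 -> y0 <= ym <= y1 ->
  (forall z, rect x0 x1 y0 y1 z -> ccont F z) ->
  rect_int F x0 x1 y0 y1 =
  rect_int F x0 xm y0 ym + rect_int F xm x1 y0 ym +
  rect_int F x0 xm ym y1 + rect_int F xm x1 ym y1.
Proof.
intros Hx Hy H.
assert (EH : forall y, y0 <= y <= y1 -> RInt (fun t => Im (F (t, y))) x0 xm + RInt (fun t => Im (F (t, y))) xm x1
  = RInt (fun t => Im (F (t, y))) x0 x1).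
{ intros y Hy'. apply (RInt_Chasles (V := R_CompleteNormedModule) (fun t => Im (F (t, y))));
  apply (ex_RInt_horizontal F Im); try apply Im_lip; try lra;
  intros t Ht; apply H; split; simpl; lra. }
assert (EV : forall x, x0 <= x <= x1 -> RInt (fun t => Re (F (x, t))) y0 ym + RInt (fun t => Re (F (x, t))) ym y1
  = RInt (fun t => Re (F (x, t))) y0 y1).
{ intros x Hx'. apply (RInt_Chasles (V := R_CompleteNormedModule) (fun t => Re (F (x, t))));
  apply (ex_RInt_vertical F Re); try apply Re_lip; try lra;
  intros t Ht; apply H; split; simpl; lra. }
unfold rect_int.
rewrite <- (EH y0), <- (EH y1), <- (EV x0), <- (EV x1) by lra. lra.
Qed.

Lemma RInt_close (f g : R -> R) (a b M : R) :
  a <= b -> ex_RInt f a b -> ex_RInt g a b ->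
  (forall t, a <= t <= b -> Rabs (f t - g t) <= M) ->
  Rabs (RInt f a b - RInt g a b) <= (b - a) * M.
Proof.
intros Hab Hf Hg H.
generalize (RInt_minus (V := R_CompleteNormedModule) f g a b Hf Hg).
change (minus (RInt f a b) (RInt g a b)) with (RInt f a b - RInt g a b).
intros <-. apply abs_RInt_le_const; auto.
apply (ex_RInt_minus (V := R_NormedModule)); auto.
Qed.

Lemma RInt_affine (a b c d : R) :
  RInt (fun t => a + b * t) c d = a * (d - c) + b * (d * d - c * c) / 2.
Proof.
apply is_RInt_unique.
replace (a * (d - c) + b * (d * d - c * c) / 2) with
  (minus (a * d + b * (d * d) / 2) (a * c + b * (c * c) / 2)).
2: unfold minus, plus, opp; simpl; field.
apply (is_RInt_derive (V := R_CompleteNormedModule) (fun t => a * t + b * (t * t) / 2)).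
- intros. auto_derive. trivial. field.
- intros x _. apply (ex_derive_continuous (V := R_NormedModule)). auto_derive. trivial.
Qed.

(** This lets the first-order part of a function at a point be subtracted for free in
    [rect_int_local]. *)
Lemma rect_int_affine (u v : C) (x0 x1 y0 y1 : R) :
  rect_int (fun z => u + v * z)%C x0 x1 y0 y1 = 0.
Proof.
destruct u as [u1 u2], v as [v1 v2]. unfold rect_int.
rewrite (RInt_ext _ (fun t => (u2 + v1 * y0) + v2 * t)).
2: intros; simpl; ring.
rewrite (RInt_ext (fun t => Im (_ + _ * (t, y1))%C) (fun t => (u2 + v1 * y1) + v2 * t)).
2: intros; simpl; ring.
rewrite (RInt_ext (fun t => Re (_ + _ * (x1, t))%C) (fun t => (u1 + v1 * x1) + (- v2) * t)).
2: intros; simpl; ring.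
rewrite (RInt_ext (fun t => Re (_ + _ * (x0, t))%C) (fun t => (u1 + v1 * x0) + (- v2) * t)).
2: intros; simpl; ring.
rewrite !RInt_affine. field.
Qed.

Lemma rect_int_close (F G : C -> C) (x0 x1 y0 y1 M : R) :
  x0 <= x1 -> y0 <= y1 ->
  (forall z, rect x0 x1 y0 y1 z -> ccont F z) ->
  (forall z, rect x0 x1 y0 y1 z -> ccont G z) ->
  (forall z, rect x0 x1 y0 y1 z -> Cmod (F z - G z) <= M) ->
  Rabs (rect_int F x0 x1 y0 y1 - rect_int G x0 x1 y0 y1) <=
  2 * ((x1 - x0) + (y1 - y0)) * M.
Proof.
intros Hx Hy HF HG HM.
assert (EH : forall y, y0 <= y <= y1 ->
  Rabs (RInt (fun t => Im (F (t, y))) x0 x1 - RInt (fun t => Im (G (t, y))) x0 x1) <= (x1 - x0) * M).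
{ intros y Hy'. apply RInt_close; auto.
  - apply (ex_RInt_horizontal F Im); try apply Im_lip; auto. intros; apply HF; split; auto.
  - apply (ex_RInt_horizontal G Im); try apply Im_lip; auto. intros; apply HG; split; auto.
  - intros t Ht. eapply Rle_trans. apply Im_lip. apply HM; split; auto. }
assert (EV : forall x, x0 <= x <= x1 ->
  Rabs (RInt (fun t => Re (F (x, t))) y0 y1 - RInt (fun t => Re (G (x, t))) y0 y1) <= (y1 - y0) * M).
{ intros x Hx'. apply RInt_close; auto.
  - apply (ex_RInt_vertical F Re); try apply Re_lip; auto. intros; apply HF; split; auto.
  - apply (ex_RInt_vertical G Re); try apply Re_lip; auto. intros; apply HG; split; auto.
  - intros t Ht. eapply Rle_trans. apply Re_lip. apply HM; split; auto. }
unfold rect_int.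
assert (A1 := EH y0 ltac:(lra)). assert (A2 := EH y1 ltac:(lra)).
assert (A3 := EV x0 ltac:(lra)). assert (A4 := EV x1 ltac:(lra)).
apply Rabs_le_between in A1, A2, A3, A4. apply Rabs_le_between. lra.
Qed.

Lemma nested_intervals (a b : nat -> R) :
  (forall n, a n <= a (S n)) -> (forall n, b (S n) <= b n) ->
  (forall n, a n <= b n) -> exists p, forall n, a n <= p <= b n.
Proof.
intros Ha Hb Hab.
assert (Ma : forall n k, a n <= a (n + k)%nat).
{ intros n k. induction k. rewrite Nat.add_0_r. lra. rewrite Nat.add_succ_r.
  eapply Rle_trans. exact IHk. apply Ha. }
assert (Mb : forall n k, b (n + k)%nat <= b n).
{ intros n k. induction k. rewrite Nat.add_0_r. lra. rewrite Nat.add_succ_r.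
  eapply Rle_trans. apply Hb. exact IHk. }
assert (B : forall n m, a m <= b n).
{ intros n m. eapply Rle_trans. apply (Ma m n). eapply Rle_trans. apply Hab.
  rewrite Nat.add_comm. apply Mb. }
destruct (completeness (fun x => exists n, x = a n)) as [p [Hp1 Hp2]].
- exists (b 0%nat). intros x [n ->]. apply B.
- exists (a 0%nat). now exists 0%nat.
- exists p. intros n. split. apply Hp1. now exists n.
  apply Hp2. intros x [m ->]. apply B.
Qed.

(** After subtracting the affine part at [p], the integrand is [(phi z - phi p) * (z - p)], at most
    [eps / 2 * s] on a small rectangle of half-perimeter [s]. Multiplying by the perimeter [2 * s]
    gives [eps * s^2]. *)
Lemma rect_int_local (F : C -> C) (p : C) (eps : R) :
  0 < eps -> cdiff F p -> exists d, 0 < d /\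
    forall x0 x1 y0 y1, rect x0 x1 y0 y1 p -> (x1 - x0) + (y1 - y0) < d ->
    (forall z, rect x0 x1 y0 y1 z -> ccont F z) ->
    Rabs (rect_int F x0 x1 y0 y1) <= eps * (((x1 - x0) + (y1 - y0)) * ((x1 - x0) + (y1 - y0))).
Proof.
intros He [phi [Hphi [d [Hd E]]]].
destruct (Hphi (eps / 2)) as [d' [Hd' Hl]]. lra.
exists (Rmin d d'). split. now apply Rmin_pos.
intros x0 x1 y0 y1 [Hx Hy] Hs HF.
set (s := (x1 - x0) + (y1 - y0)) in *.
assert (S : forall z, rect x0 x1 y0 y1 z -> Cmod (z - p) <= s).
{ intros [x y] [Hzx Hzy]. destruct p as [px py]. simpl in *.
  eapply Rle_trans. apply (Cmod_le_Rabs (x - px) (y - py)).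
  unfold s. apply Rplus_le_compat; apply Rabs_le_between; lra. }
rewrite <- (Rminus_0_r (rect_int F _ _ _ _)).
rewrite <- (rect_int_affine (F p - phi p * p)%C (phi p) x0 x1 y0 y1).
eapply Rle_trans. apply rect_int_close with (M := eps / 2 * s); try lra; auto.
- intros z _. apply ccont_plus. apply ccont_const. apply ccont_mult. apply ccont_const. apply ccont_id.
- intros z Hz. assert (Hz' := S z Hz).
  rewrite E. 2: eapply Rle_lt_trans; [exact Hz' | eapply Rlt_le_trans; [exact Hs | apply Rmin_l]].
  replace (F p + phi z * (z - p) - (F p - phi p * p + phi p * z))%C with ((phi z - phi p) * (z - p))%C by ring.
  rewrite Cmod_mult. apply Rmult_le_compat; try apply Cmod_ge_0; auto.
  left. apply Hl. eapply Rle_lt_trans; [exact Hz' | eapply Rlt_le_trans; [exact Hs | apply Rmin_r]].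
- fold s. apply Req_le. field.
Qed.

(* Bisection: if the integral exceeds [eps * (width + height)^2], so does that of
   one of the four quarters, contradicting [rect_int_local] at the limit point. *)
Lemma goursat (F : C -> C) (x0 x1 y0 y1 : R) :
  x0 <= x1 -> y0 <= y1 ->
  (forall z, rect x0 x1 y0 y1 z -> cdiff F z) ->
  rect_int F x0 x1 y0 y1 = 0.
Proof.
intros Hx Hy HF.
set (w := x1 - x0). set (h := y1 - y0).
destruct (Req_dec (rect_int F x0 x1 y0 y1) 0) as [|N]; auto. exfalso.
assert (P := Rabs_pos_lt _ N).
(* Chosen so that [eps * (w + h)^2] is below the integral; the [+ 1] covers the degenerate rectangle
   with [w + h = 0]. *)
set (eps := Rabs (rect_int F x0 x1 y0 y1) / (2 * ((w + h) * (w + h) + 1))).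
assert (Sq : 0 <= (w + h) * (w + h)) by apply (Rle_0_sqr (w + h)).
assert (Q : 0 < 2 * ((w + h) * (w + h) + 1)) by lra.
assert (He : 0 < eps) by (apply Rdiv_lt_0_compat; auto).
assert (H0 : eps * ((w + h) * (w + h)) < Rabs (rect_int F x0 x1 y0 y1)).
{ replace (Rabs (rect_int F x0 x1 y0 y1)) with (eps * (2 * ((w + h) * (w + h) + 1))).
  apply Rmult_lt_compat_l; auto. lra. unfold eps. field. lra. }
set (W := fun n => w * (/ 2) ^ n). set (H := fun n => h * (/ 2) ^ n).
assert (Pn : forall n, 0 < (/ 2) ^ n) by (intros; apply pow_lt; lra).
assert (HW : forall n, W n = W (S n) + W (S n)) by (intros; unfold W; simpl; field).
assert (HH : forall n, H n = H (S n) + H (S n)) by (intros; unfold H; simpl; field).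
assert (W0 : forall n, 0 <= W n) by (intros; apply Rmult_le_pos; [unfold w; lra | left; apply Pn]).
assert (H0' : forall n, 0 <= H n) by (intros; apply Rmult_le_pos; [unfold h; lra | left; apply Pn]).
set (big := fun n (q : R * R) =>
  rect x0 x1 y0 y1 q /\ rect x0 x1 y0 y1 (fst q + W n, snd q + H n) /\
  eps * ((W n + H n) * (W n + H n)) < Rabs (rect_int F (fst q) (fst q + W n) (snd q) (snd q + H n))).
(* The hypothesis [big] sits under the existential so that choice yields a total function [next],
   which can be iterated before bigness is known. *)
assert (step : forall nq : nat * (R * R), exists q', big (fst nq) (snd nq) ->
  big (S (fst nq)) q' /\
  fst (snd nq) <= fst q' /\ fst q' + W (S (fst nq)) <= fst (snd nq) + W (fst nq) /\
  snd (snd nq) <= snd q' /\ snd q' + H (S (fst nq)) <= snd (snd nq) + H (fst nq)).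
{ intros [n [x y]]. simpl.
  destruct (classic (big n (x, y))) as [B|B]. 2: exists (x, y); tauto.
  apply NNPP. intros NE.
  (* [i] and [j] select a quarter. Halving both sides divides the bound by 4, so four small quarters
     would make the whole rectangle small, against [B5]. *)
  assert (small : forall i j : R, (i = 0 \/ i = 1) -> (j = 0 \/ j = 1) ->
    Rabs (rect_int F (x + i * W (S n)) (x + i * W (S n) + W (S n)) (y + j * H (S n)) (y + j * H (S n) + H (S n)))
    <= eps * ((W (S n) + H (S n)) * (W (S n) + H (S n)))).
  { intros i j Hi Hj. apply Rnot_lt_le. intros L. apply NE.
    exists (x + i * W (S n), y + j * H (S n)). intros _.
    destruct B as [[B1 B2] [[B3 B4] _]]. simpl in *.
    assert (A1 := W0 (S n)). assert (A2 := H0' (S n)). assert (E1 := HW n). assert (E2 := HH n).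
    unfold big, rect; simpl.
    destruct Hi as [-> | ->], Hj as [-> | ->]; (split; [split; [lra | split; [lra | exact L]] | lra]). }
  destruct B as [[B1 B2] [[B3 B4] B5]]. simpl in *.
  apply (Rlt_irrefl (Rabs (rect_int F x (x + W n) y (y + H n)))).
  eapply Rle_lt_trans. 2: exact B5.
  assert (A1 := W0 (S n)). assert (A2 := H0' (S n)).
  rewrite (HW n) in B3 |- *. rewrite (HH n) in B4 |- *.
  rewrite (rect_int_split F x (x + W (S n)) _ y (y + H (S n))) by
   (try lra; intros z [Hz1 Hz2]; apply cdiff_ccont, HF; split; lra).
  assert (S1 := small 0 0 ltac:(tauto) ltac:(tauto)).
  assert (S2 := small 1 0 ltac:(tauto) ltac:(tauto)).
  assert (S3 := small 0 1 ltac:(tauto) ltac:(tauto)).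
  assert (S4 := small 1 1 ltac:(tauto) ltac:(tauto)).
  rewrite !Rmult_0_l, !Rplus_0_r in *. rewrite !Rmult_1_l in *.
  rewrite <- !(Rplus_assoc x), <- !(Rplus_assoc y).
  apply Rabs_le_between in S1, S2, S3, S4. apply Rabs_le_between. lra. }
set (next := fun nq => proj1_sig (constructive_indefinite_description _ (step nq))).
set (q := fix q n := match n with O => (x0, y0) | S m => next (m, q m) end).
assert (Bq : forall n, big n (q n)).
{ induction n.
  - unfold big, rect, W, H; simpl. rewrite !Rmult_1_r. unfold w, h in *.
    replace (x0 + (x1 - x0)) with x1 by ring. replace (y0 + (y1 - y0)) with y1 by ring.
    repeat split; lra.
  - simpl. unfold next at 1. destruct (constructive_indefinite_description _ _) as [q' Hq']. simpl in *.
    now apply Hq'. }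
assert (Mq : forall n, fst (q n) <= fst (q (S n)) /\ fst (q (S n)) + W (S n) <= fst (q n) + W n /\
  snd (q n) <= snd (q (S n)) /\ snd (q (S n)) + H (S n) <= snd (q n) + H n).
{ intros n. simpl. unfold next. destruct (constructive_indefinite_description _ _) as [q' Hq']. simpl in *.
    now apply Hq'. }
destruct (nested_intervals (fun n => fst (q n)) (fun n => fst (q n) + W n)) as [px Hpx].
{ intros; apply Mq. } { intros; apply Mq. } { intros n; generalize (W0 n); lra. }
destruct (nested_intervals (fun n => snd (q n)) (fun n => snd (q n) + H n)) as [py Hpy].
{ intros; apply Mq. } { intros; apply Mq. } { intros n; generalize (H0' n); lra. }
assert (Hp : rect x0 x1 y0 y1 (px, py)).
{ destruct (Bq 0%nat) as [[B1 B2] [[B3 B4] _]]. simpl in *. specialize (Hpx 0%nat). specialize (Hpy 0%nat).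
  simpl in *. split; simpl; lra. }
destruct (rect_int_local F (px, py) eps He (HF _ Hp)) as [d [Hd Hl]].
assert (Hs : 0 <= w + h) by (unfold w, h; lra).
destruct (pow_lt_1_zero (/ 2) ltac:(rewrite Rabs_pos_eq; lra) (d / (w + h + 1))) as [n Hn].
{ apply Rdiv_lt_0_compat; lra. }
specialize (Hn n (le_n _)). rewrite Rabs_pos_eq in Hn by (left; apply Pn).
destruct (Bq n) as [[B1 B2] [[B3 B4] B5]]. simpl in *.
apply (Rlt_irrefl (eps * ((W n + H n) * (W n + H n)))). eapply Rlt_le_trans. exact B5.
eapply Rle_trans. apply Hl.
- split; simpl; auto.
- replace (fst (q n) + W n - fst (q n) + (snd (q n) + H n - snd (q n))) with ((w + h) * (/ 2) ^ n)
    by (unfold W, H; ring).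
  apply Rle_lt_trans with ((w + h + 1) * (/ 2) ^ n).
  apply Rmult_le_compat_r. left; apply Pn. lra.
  apply Rmult_lt_compat_l with (r := w + h + 1) in Hn; [|lra].
  replace ((w + h + 1) * (d / (w + h + 1))) with d in Hn by (field; lra). exact Hn.
- intros z [Hz1 Hz2]. apply cdiff_ccont, HF. split; lra.
- apply Req_le. f_equal. ring.
Qed.

(** * The mean value property *)

Definition cexp (z : C) : C := (exp (fst z) * cos (snd z), exp (fst z) * sin (snd z)).

Lemma cexp_plus (z w : C) : cexp (z + w)%C = (cexp z * cexp w)%C.
Proof.
destruct z as [a b], w as [c d]. unfold cexp, Cplus, Cmult; simpl.
rewrite exp_plus, cos_plus, sin_plus. f_equal; ring.
Qed.

Lemma Cmod_cexp (z : C) : Cmod (cexp z) = exp (fst z).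
Proof.
unfold Cmod, cexp; simpl.
assert (H := sin2_cos2 (snd z)). unfold Rsqr in H.
replace (_ + _) with (exp (fst z) * exp (fst z) * (sin (snd z) * sin (snd z) + cos (snd z) * cos (snd z))) by ring.
rewrite H, Rmult_1_r. apply sqrt_square. left; apply exp_pos.
Qed.

Definition polar (r t : R) : C := (r * cos t, r * sin t).

(** The lower bound is [1 + x <= exp x]. The same inequality at [- x] gives [exp x * (1 - x) <= 1],
    and [(1 + x + 2 * x^2) * (1 - x) >= 1] as soon as [x <= 1/2]. *)
Lemma exp_approx (x : R) : Rabs x <= / 2 -> Rabs (exp x - 1 - x) <= 2 * (x * x).
Proof.
intros Hx. apply Rabs_le_between in Hx.
assert (A := exp_ineq1_le x). assert (B := exp_ineq1_le (- x)).
assert (E : exp x * exp (- x) = 1) by (rewrite <- exp_plus, Rplus_opp_r; apply exp_0).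
assert (P := exp_pos x).
assert (U : exp x <= 1 + x + 2 * (x * x)).
{ apply Rmult_le_reg_r with (1 - x). lra.
  apply Rle_trans with 1. rewrite <- E. apply Rmult_le_compat_l; lra.
  replace ((1 + x + 2 * (x * x)) * (1 - x)) with (1 + (x * x) * (1 - 2 * x)) by ring.
  assert (0 <= (x * x) * (1 - 2 * x)). apply Rmult_le_pos. apply (Rle_0_sqr x). lra. lra. }
apply Rabs_le_between. assert (S := Rle_0_sqr x). unfold Rsqr in S. lra.
Qed.

Lemma Rabs_sin_le (y : R) : Rabs (sin y) <= Rabs y.
Proof.
destruct (MVT_gen sin 0 y cos) as [c [_ Hc]].
- intros x _. apply is_derive_Reals, derivable_pt_lim_sin.
- intros x _. apply continuity_sin.
- rewrite sin_0, !Rminus_0_r in Hc. rewrite Hc, Rabs_mult.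
  rewrite <- (Rmult_1_l (Rabs y)) at 2. apply Rmult_le_compat_r. apply Rabs_pos.
  apply Rabs_le_between. generalize (COS_bound c). lra.
Qed.

Lemma cos_approx (y : R) : Rabs (cos y - 1) <= y * y / 2.
Proof.
replace y with (2 * (y / 2)) at 1 by field. rewrite cos_2a_sin.
assert (H := Rabs_sin_le (y / 2)). apply Rsqr_le_abs_1 in H. unfold Rsqr in H.
assert (S := Rle_0_sqr (sin (y / 2))). unfold Rsqr in S.
rewrite Rabs_left1; lra.
Qed.

(** The mean value theorem turns the difference into [(cos c - 1) * y] with [c] between 0 and [y];
    the cubic bound from [cos_approx] is weakened using [Rabs y <= 1]. *)
Lemma sin_approx (y : R) : Rabs y <= 1 -> Rabs (sin y - y) <= y * y / 2.
Proof.
intros Hy.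
destruct (MVT_gen (fun t => sin t - t) 0 y (fun t => cos t - 1)) as [c [Hc Ec]].
- intros x _. auto_derive. trivial. ring.
- intros x _. apply continuity_pt_minus. apply continuity_sin. apply derivable_continuous_pt, derivable_pt_id.
- rewrite sin_0, !Rminus_0_r in Ec. rewrite Ec, Rabs_mult.
  assert (A := cos_approx c).
  assert (B : c * c <= y * y).
  { apply (Rsqr_le_abs_1 c y). apply Rabs_le_between in Hy.
    destruct (Rle_dec 0 y).
    - rewrite Rmin_left, Rmax_right in Hc by lra. rewrite !Rabs_pos_eq; lra.
    - rewrite Rmin_right, Rmax_left in Hc by lra. rewrite !Rabs_left1; lra. }
  assert (P := Rabs_pos y). assert (P' := Rabs_pos (cos c - 1)). nra.
Qed.

Lemma cdiff_of_quadratic (F : C -> C) (p l : C) (d K : R) :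
  0 < d -> 0 < K -> (forall x, Cmod (x - p) < d ->
    Cmod (F x - F p - l * (x - p)) <= K * (Cmod (x - p) * Cmod (x - p))) ->
  cdiff F p.
Proof.
intros Hd HK H.
exists (fun x => if excluded_middle_informative (x = p) then l else ((F x - F p) / (x - p))%C).
split.
- intros e He. exists (Rmin d (e / K)). split.
  apply Rmin_pos; auto. now apply Rdiv_lt_0_compat.
  intros x Hx.
  destruct (excluded_middle_informative (p = p)) as [_|N]; [|now elim N].
  destruct (excluded_middle_informative (x = p)) as [Ex|N].
  rewrite Cmod_self; lra.
  assert (P := Cmod_sub_pos _ _ N). assert (N' := Csub_neq _ _ N).
  specialize (H x (Rlt_le_trans _ _ _ Hx (Rmin_l _ _))).
  apply Rlt_le_trans with (2 := Rmin_r _ _) in Hx.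
  apply Rmult_lt_reg_r with (Cmod (x - p)); auto. rewrite <- Cmod_mult.
  replace (((F x - F p) / (x - p) - l) * (x - p))%C with (F x - F p - l * (x - p))%C by (field; auto).
  eapply Rle_lt_trans. exact H. rewrite <- Rmult_assoc. apply Rmult_lt_compat_r; auto.
  apply Rmult_lt_compat_l with (r := K) in Hx; auto.
  replace (K * (e / K)) with e in Hx by (field; lra). exact Hx.
- exists 1. split. lra. intros x _.
  destruct (excluded_middle_informative (x = p)) as [Ex|N].
  rewrite Ex; ring. field. now apply Csub_neq.
Qed.

Lemma cdiff_cexp_0 : cdiff cexp (RtoC 0).
Proof.
(* [/ 2] is the range of [exp_approx]. The four remainder terms below total at most 6 times the
   squared modulus, so 8 leaves slack. *)
apply cdiff_of_quadratic with (l := RtoC 1) (d := / 2) (K := 8); try lra.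
intros [x y] H.
replace ((x, y) - 0)%C with ((x, y) : C) in * by (unfold Cminus, Cplus, Copp, RtoC; simpl; f_equal; ring).
assert (Hx := re_le_Cmod (x, y)). assert (Hy := im_le_Cmod (x, y)). unfold Re, Im in Hx, Hy. simpl in Hx, Hy.
set (m := Cmod (x, y)) in *.
replace (cexp (x, y) - cexp 0 - 1 * (x, y))%C with
  ((exp x - 1 - x + exp x * (cos y - 1), exp x * (sin y - y) + (exp x - 1) * y) : C).
2: { unfold cexp, Cminus, Cplus, Copp, Cmult, RtoC; simpl. rewrite exp_0, cos_0, sin_0. f_equal; ring. }
eapply Rle_trans. apply Cmod_le_Rabs.
assert (A := exp_approx x ltac:(lra)).
assert (B := cos_approx y). assert (D := sin_approx y ltac:(lra)).
assert (X2 : x * x <= m * m). { rewrite <- (Rabs_pos_eq m) in Hx by apply Cmod_ge_0. exact (Rsqr_le_abs_1 _ _ Hx). }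
assert (Y2 : y * y <= m * m). { rewrite <- (Rabs_pos_eq m) in Hy by apply Cmod_ge_0. exact (Rsqr_le_abs_1 _ _ Hy). }
assert (M2 : m * m <= / 2 * m). { apply Rmult_le_compat_r. apply Cmod_ge_0. lra. }
assert (E1 : Rabs (exp x - 1) <= 2 * m).
{ replace (exp x - 1) with ((exp x - 1 - x) + x) by ring. eapply Rle_trans. apply Rabs_triang. lra. }
assert (E2 : 0 <= exp x <= 2).
{ apply Rabs_le_between in E1. generalize (exp_pos x). lra. }
assert (T1 : Rabs (exp x * (cos y - 1)) <= 2 * (m * m / 2)).
{ rewrite Rabs_mult, (Rabs_pos_eq (exp x)) by lra. apply Rmult_le_compat; try lra. apply Rabs_pos. }
assert (T2 : Rabs (exp x * (sin y - y)) <= 2 * (m * m / 2)).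
{ rewrite Rabs_mult, (Rabs_pos_eq (exp x)) by lra. apply Rmult_le_compat; try lra. apply Rabs_pos. }
assert (T3 : Rabs ((exp x - 1) * y) <= 2 * m * m).
{ rewrite Rabs_mult. apply Rmult_le_compat; try lra; apply Rabs_pos. }
assert (T4 := Rabs_triang (exp x - 1 - x) (exp x * (cos y - 1))).
assert (T5 := Rabs_triang (exp x * (sin y - y)) ((exp x - 1) * y)).
assert (M0 := Rle_0_sqr m). unfold Rsqr in M0. lra.
Qed.

Lemma cdiff_cexp (p : C) : cdiff cexp p.
Proof.
apply cdiff_local with (fun z => cexp p * cexp (z - p))%C 1. lra.
{ intros z _. rewrite <- cexp_plus. f_equal. ring. }
apply cdiff_mult. apply cdiff_const.
apply (cdiff_comp cexp (fun z => z - p)%C).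
apply cdiff_minus. apply cdiff_id. apply cdiff_const.
replace (p - p)%C with (0 : C) by ring. apply cdiff_cexp_0.
Qed.

(* In logarithmic coordinates [z = p + cexp w], Goursat's theorem on
   [s, ln r] x [0, 2 PI] says that the circle averages do not depend on the
   radius, since the horizontal sides cancel; the radius then shrinks to 0.
   The centre itself is never in the image, so continuity suffices there. *)
Lemma mean_value (F : C -> C) (p : C) (r0 r : R) :
  0 < r < r0 -> ccont F p ->
  (forall z, 0 < Cmod (z - p) < r0 -> cdiff F z) ->
  is_RInt (fun t => Re (F (p + polar r t)%C)) 0 (2 * PI) (2 * PI * Re (F p)).
Proof.
intros Hr Hc HF. assert (HPI := PI_RGT_0).
set (H := fun w => F (p + cexp w)%C).
assert (HH : forall x y, x <= ln r -> cdiff H (x, y)).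
{ intros x y Hx. apply (cdiff_comp F (fun w => p + cexp w)%C).
  apply cdiff_plus. apply cdiff_const. apply cdiff_cexp.
  apply HF. replace (p + cexp (x, y) - p)%C with (cexp (x, y)) by ring.
  rewrite Cmod_cexp. simpl. split. apply exp_pos.
  apply Rle_lt_trans with (2 := proj2 Hr). rewrite <- (exp_ln r) by lra.
  destruct Hx as [Hx| ->]. left; now apply exp_increasing. lra. }
set (A := fun s => RInt (fun t => Re (H (s, t))) 0 (2 * PI)).
assert (EA : forall s, s <= ln r -> ex_RInt (fun t => Re (H (s, t))) 0 (2 * PI)).
{ intros s Hs. apply (ex_RInt_vertical H Re). apply Re_lip. lra.
  intros. apply cdiff_ccont. now apply HH. }
assert (Const : forall s, s <= ln r -> A (ln r) = A s).
{ intros s Hs. assert (G := goursat H s (ln r) 0 (2 * PI) Hs ltac:(lra)).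
  unfold rect_int in G. fold (A s) (A (ln r)) in G.
  (* [cexp] has period 2 pi i, so top and bottom sides carry the same integrand. *)
  rewrite (RInt_ext (fun t => Im (H (t, 2 * PI))) (fun t => Im (H (t, 0)))) in G.
  apply Rminus_diag_uniq. rewrite <- G. ring.
  intros z [Hz _]. destruct z as [x y]. apply HH. simpl in Hz. lra.
  intros t _. unfold H, cexp. simpl. now rewrite cos_2PI, sin_2PI, cos_0, sin_0. }
assert (L : A (ln r) = 2 * PI * Re (F p)).
{ apply Rminus_diag_uniq. apply NNPP. intros N. apply Rabs_pos_lt in N.
  set (e := Rabs (A (ln r) - 2 * PI * Re (F p))) in *.
  destruct (Hc (e / (4 * PI))) as [d [Hd Hl]]. apply Rdiv_lt_0_compat; lra.
  set (m := Rmin r (d / 2)). assert (Hm : 0 < m) by (apply Rmin_pos; lra).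
  assert (Hm1 : m <= r) by apply Rmin_l. assert (Hm2 : m <= d / 2) by apply Rmin_r.
  assert (Hs : ln m <= ln r). { destruct Hm1 as [Hm1| ->]. left; now apply ln_increasing. lra. }
  assert (B := RInt_close (fun t => Re (H (ln m, t))) (fun _ => Re (F p)) 0 (2 * PI) (e / (4 * PI))
    ltac:(lra) (EA _ Hs) (ex_RInt_const _ _ _)).
  rewrite RInt_const in B. fold (A (ln m)) in B. rewrite <- (Const _ Hs) in B.
  change (scal (2 * PI - 0) (Re (F p))) with ((2 * PI - 0) * Re (F p)) in B.
  rewrite Rminus_0_r in B. fold e in B.
  assert (e <= 2 * PI * (e / (4 * PI))).
  { apply B. intros t _. left. eapply Rle_lt_trans. apply Re_lip. apply Hl.
    replace (p + cexp (ln m, t) - p)%C with (cexp (ln m, t)) by ring.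
    rewrite Cmod_cexp. simpl. rewrite exp_ln; lra. }
  replace (2 * PI * (e / (4 * PI))) with (e / 2) in * by (field; lra). lra. }
rewrite <- L. apply is_RInt_ext with (fun t => Re (H (ln r, t))).
- intros t _. unfold H, cexp, polar. simpl. now rewrite exp_ln by lra.
- apply (RInt_correct (V := R_CompleteNormedModule)). apply EA. lra.
Qed.

(** * Compactness and the maximum principle *)

(** Every point is given a disc that either misses [S] or lies in one member of the cover. These
    radii form a gauge, and [compactness_list] extracts finitely many discs covering the square of
    half-side [M]; it is stated under a double negation, whence [NNPP]. *)
Lemma compact_closed_bounded (S : C -> Prop) (M : R) :
  open (fun z => ~ S z) -> (forall z, S z -> Cmod z <= M) -> compact_set S.
Proof.
intros HS HM I V HV Hcov.
assert (D : forall t : C, exists d, 0 < d /\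
  ((forall x, Cmod (x - t) < d -> ~ S x) \/ exists i, forall x, Cmod (x - t) < d -> V i x)).
{ intros t. destruct (classic (S t)) as [Ht|Ht].
  - destruct (Hcov t Ht) as [i Hi].
    destruct (proj1 (open_Cmod _) (HV i) t Hi) as [d [Hd H]]. exists d. split; auto. right. now exists i.
  - destruct (proj1 (open_Cmod _) HS t Ht) as [d [Hd H]]. exists d. split; auto. }
set (rad := fun t => proj1_sig (constructive_indefinite_description _ (D t))).
assert (Hrad : forall t, 0 < rad t /\
  ((forall x, Cmod (x - t) < rad t -> ~ S x) \/ exists i, forall x, Cmod (x - t) < rad t -> V i x)).
{ intros t. unfold rad. now destruct (constructive_indefinite_description _ _). }
(* Closeness in the gauge is coordinatewise: two coordinates within [rad / 2] give a modulus below
   [rad]. *)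
assert (Hr2 : forall t, 0 < rad t / 2) by (intros t; generalize (proj1 (Hrad t)); lra).
set (pt := fun t : Compactness.Tn 2 R => (fst t, fst (snd t)) : C).
destruct (NNPP _ (compactness_list 2 (- M, (- M, tt)) (M, (M, tt))
  (fun t => mkposreal _ (Hr2 (pt t))))) as [l Hl].
assert (G : forall l', exists li : list I, forall z, S z ->
  (exists t, In t l' /\ Cmod (z - pt t) < rad (pt t)) -> exists i, In i li /\ V i z).
{ intros l'. induction l' as [|t l' [li IH]].
  - exists nil. intros z _ [t [[] _]].
  - destruct (Hrad (pt t)) as [_ [H|[i H]]].
    + exists li. intros z Hz [t' [[<-|Ht'] H']]. now elim (H _ H').
      apply IH; auto. now exists t'.
    + exists (i :: li). intros z Hz [t' [[<-|Ht'] H']].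
      exists i. split. now left. now apply H.
      destruct (IH z Hz) as [j [Hj Hj']]. now exists t'. exists j. split; auto. now right. }
destruct (G l) as [li Hli]. exists li. intros [x y] Hz. apply Hli; auto.
destruct (Hl (x, (y, tt))) as [[u [v []]] [Hin [_ Hclose]]].
- assert (A := HM _ Hz). assert (A1 := re_le_Cmod (x, y)). assert (A2 := im_le_Cmod (x, y)).
  simpl in A1, A2. apply Rabs_le_between in A1, A2. simpl. repeat split; lra.
- exists (u, (v, tt)). split. exact Hin. simpl in Hclose.
  destruct Hclose as [C1 [C2 _]]. unfold pt in *; simpl in *.
  eapply Rle_lt_trans. apply (Cmod_le_Rabs (x - u) (y - v)). lra.
Qed.

(** Lower semicontinuity on [S] is enough. Without a minimum, the sets where [h] locally exceeds
    [h w], for [w] in [S], cover [S]. In a finite subcover the index with least [h] is itself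
    covered, by an index with a smaller value. Maxima are obtained by negating [h]. *)
Lemma compact_min (S : C -> Prop) (h : C -> R) :
  compact_set S -> (exists z, S z) ->
  (forall z, S z -> forall eps, 0 < eps -> exists d, 0 < d /\
    forall x, S x -> Cmod (x - z) < d -> h z - eps < h x) ->
  exists m, S m /\ forall z, S z -> h m <= h z.
Proof.
intros HS [z0 Hz0] Hh. apply NNPP. intros N.
assert (E : forall z, S z -> exists w, S w /\ h w < h z).
{ intros z Hz. apply NNPP. intros N'. apply N. exists z. split; auto.
  intros w Hw. apply Rnot_lt_le. intros L. apply N'. now exists w. }
destruct (HS C (fun w z => S w /\ exists d, 0 < d /\ forall x, S x -> Cmod (x - z) < d -> h w < h x))
  as [l Hl].
- intros w. apply open_Cmod. intros z [Hw [d [Hd H]]]. exists (d / 2). split. lra.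
  intros x Hx. split; auto. exists (d / 2). split. lra.
  intros y Hy Hyx. apply H; auto. eapply Rle_lt_trans. apply (Cmod_sub_triangle y x z). lra.
- intros z Hz. destruct (E z Hz) as [w [Hw L]]. exists w. split; auto.
  destruct (Hh z Hz (h z - h w)) as [d [Hd H]]. lra.
  exists d. split; auto. intros x Hx Hx'. generalize (H x Hx Hx'). lra.
- assert (G : forall l', (exists w, In w l' /\ S w) ->
    exists w, In w l' /\ S w /\ forall w', In w' l' -> S w' -> h w <= h w').
  { induction l' as [|a l' IH]; intros [w [Hin Hw]]. easy.
    destruct (classic (exists w, In w l' /\ S w)) as [Ex|NE].
    - destruct (IH Ex) as [m [Hm [Sm Hmin]]].
      destruct (classic (S a /\ h a < h m)) as [[Sa La]|NA].
      + exists a. split. now left. split; auto. intros w' [<-|H'] Sw'. lra.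
        generalize (Hmin w' H' Sw'). lra.
      + exists m. split. now right. split; auto. intros w' [<-|H'] Sw'; auto.
        apply Rnot_lt_le. tauto.
    - destruct Hin as [->|Hin]. 2: elim NE; now exists w.
      exists w. split. now left. split; auto. intros w' [<-|H'] Sw'. lra.
      elim NE; now exists w'. }
  destruct (G l) as [m [Hm [Sm Hmin]]].
  + destruct (Hl z0 Hz0) as [w [Hw [Sw _]]]. now exists w.
  + destruct (Hl m Sm) as [w [Hw [Sw [d [Hd H]]]]].
    generalize (Hmin w Hw Sw). generalize (H m Sm). rewrite Cmod_self. intros A B.
    specialize (A Hd). lra.
Qed.

Lemma open_Cmod_gt (c : C) (r : R) : open (fun z => r < Cmod (z - c)).
Proof.
apply open_Cmod. intros z Hz. exists (Cmod (z - c) - r). split. lra.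
intros x Hx. generalize (Cmod_sub_triangle z x c). rewrite (Cmod_sub_sym z x). lra.
Qed.

Lemma compact_closed_disc (c : C) (r : R) : compact_set (fun z => Cmod (z - c) <= r).
Proof.
apply compact_closed_bounded with (r + Cmod c).
- intros z Hz. generalize (open_Cmod_gt c r z ltac:(lra)).
  apply filter_imp. intros. lra.
- intros z Hz. generalize (Cmod_triangle (z - c) c). replace (z - c + c)%C with z by ring. lra.
Qed.

Lemma compact_circle (c : C) (r : R) : compact_set (fun z => Cmod (z - c) = r).
Proof.
apply compact_closed_bounded with (r + Cmod c).
- apply open_Cmod. intros z Hz. exists (Rabs (Cmod (z - c) - r)).
  split. apply Rabs_pos_lt. lra. intros x Hx E.
  generalize (Cmod_sub_triangle z x c) (Cmod_sub_triangle x z c). rewrite (Cmod_sub_sym z x).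
  intros. apply (Rlt_irrefl (Cmod (x - z))). eapply Rlt_le_trans. exact Hx.
  apply Rabs_le_between. lra.
- intros z Hz. generalize (Cmod_triangle (z - c) c). replace (z - c + c)%C with z by ring. lra.
Qed.

(* [Re F + eps |z - c|^2] is strictly subharmonic, so its maximum over the disc
   is on the boundary. *)
Lemma max_principle_Re (F : C -> C) (c q : C) (r M : R) :
  (forall z, Cmod (z - c) <= r -> ccont F z) ->
  (forall z, Cmod (z - c) <= r -> z <> q -> cdiff F z) ->
  (forall z, Cmod (z - c) = r -> Re (F z) <= M) ->
  forall z, Cmod (z - c) <= r -> Re (F z) <= M.
Proof.
intros Hc Hd HM z0 Hz0. apply le_epsilon. intros e0 He0.
assert (Hr : 0 <= r) by (generalize (Cmod_ge_0 (z0 - c)); lra).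
set (eps := e0 / (r * r + 1)).
assert (Hr1 : 0 < r * r + 1) by (generalize (Rle_0_sqr r); unfold Rsqr; lra).
assert (He : 0 < eps) by (apply Rdiv_lt_0_compat; lra).
assert (Her : eps * (r * r) <= e0).
{ replace e0 with (eps * (r * r + 1)) by (unfold eps; field; lra).
  apply Rmult_le_compat_l; lra. }
set (v := fun z => Re (F z) + eps * (Cmod (z - c) * Cmod (z - c))).
destruct (compact_min (fun z => Cmod (z - c) <= r) (fun z => - v z)) as [p [Hp Hmax]].
- apply compact_closed_disc.
- now exists z0.
- intros z Hz e Hepos.
  destruct (Hc z Hz (e / 2)) as [d [Hdpos H]]. lra.
  set (K := eps * (2 * r + 1)). assert (HK : 0 < K) by (apply Rmult_lt_0_compat; lra).
  exists (Rmin d (e / (2 * K))). split. apply Rmin_pos; auto. apply Rdiv_lt_0_compat; lra.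
  intros x Hx Hxz. unfold v.
  assert (A := H x (Rlt_le_trans _ _ _ Hxz (Rmin_l _ _))).
  assert (B := Rlt_le_trans _ _ _ Hxz (Rmin_r _ _)).
  assert (A' := Re_lip (F x) (F z)). assert (A2 := Rle_lt_trans _ _ _ A' A).
  apply Rabs_lt_between in A2.
  assert (T := Cmod_sub_triangle x z c).
  assert (P1 := Cmod_ge_0 (x - c)). assert (P2 := Cmod_ge_0 (z - c)).
  set (a := Cmod (x - c)) in *. set (b := Cmod (z - c)) in *. set (s := Cmod (x - z)) in *.
  assert (Hs : 0 <= s) by apply Cmod_ge_0.
  assert (Q : a * a - b * b <= s * (2 * r + 1)).
  { replace (a * a - b * b) with ((a - b) * (a + b)) by ring.
    apply Rle_trans with (s * (a + b)). apply Rmult_le_compat_r; lra.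
    apply Rmult_le_compat_l; lra. }
  assert (Q2 : eps * (a * a - b * b) <= s * K).
  { unfold K. replace (s * (eps * (2 * r + 1))) with (eps * (s * (2 * r + 1))) by ring.
    apply Rmult_le_compat_l; lra. }
  assert (Q3 : s * K < e / 2).
  { replace (e / 2) with (e / (2 * K) * K) by (field; lra). apply Rmult_lt_compat_r; auto. }
  lra.
- assert (Hv : forall z, Cmod (z - c) <= r -> v z <= v p).
  { intros z Hz. generalize (Hmax z Hz). lra. }
  assert (V0 := Hv z0 Hz0).
  assert (S0 := Rle_0_sqr (Cmod (z0 - c))). unfold Rsqr in S0.
  assert (S1 := Rmult_le_pos _ _ (Rlt_le _ _ He) S0).
  destruct (Req_dec (Cmod (p - c)) r) as [Ep|Np].
  + assert (B := HM p Ep). unfold v in V0. rewrite Ep in V0. lra.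
  + exfalso. assert (Hlt : Cmod (p - c) < r) by lra.
    (* The disc about [p] must stay inside and avoid [q]. If [p = q], puncturing it is enough, since
       [mean_value] does not ask for differentiability at the centre. *)
    assert (R0 : exists r0, 0 < r0 /\ r0 <= r - Cmod (p - c) /\
      forall z, 0 < Cmod (z - p) < r0 -> z <> q).
    { destruct (classic (p = q)) as [<-|Npq].
      - exists (r - Cmod (p - c)). split. lra. split. lra.
        intros z Hz ->. rewrite Cmod_self in Hz. lra.
      - exists (Rmin (r - Cmod (p - c)) (Cmod (q - p))). split.
        apply Rmin_pos. lra. now apply Cmod_sub_pos, not_eq_sym.
        split. apply Rmin_l. intros z [_ Hz] ->.
        apply Rlt_le_trans with (2 := Rmin_r _ _) in Hz. lra. }
    destruct R0 as [r0 [Hr0 [Hr0' Hq]]].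
    assert (In : forall z, Cmod (z - p) < r0 -> Cmod (z - c) <= r).
    { intros z Hz. generalize (Cmod_sub_triangle z p c). lra. }
    assert (MV := mean_value F p r0 (r0 / 2) ltac:(lra) (Hc p Hp)
      (fun z Hz => Hd z (In z (proj2 Hz)) (Hq z Hz))).
    set (s := r0 / 2) in *. assert (Hs : 0 < s) by (unfold s; lra).
    destruct (p - c)%C as [a b] eqn:Epc.
    (* Maximality of [v p] bounds [Re F] on the circle by [v p - eps * |z - c|^2], which is [g] once
       the square is expanded. The trigonometric terms have mean zero, so averaging gives
       [Re (F p) <= Re (F p) - eps * s^2]. *)
    set (g := fun t => v p - eps * (a * a + b * b + s * s + 2 * s * (a * cos t + b * sin t))).
    assert (MG : is_RInt g 0 (2 * PI) (2 * PI * (v p - eps * (a * a + b * b + s * s)))).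
    { set (G := fun t => (v p - eps * (a * a + b * b + s * s)) * t - eps * (2 * s * (a * sin t - b * cos t))).
      replace (2 * PI * (v p - eps * (a * a + b * b + s * s))) with (minus (G (2 * PI)) (G 0)).
      2: unfold G, minus, plus, opp; simpl; rewrite sin_2PI, cos_2PI, sin_0, cos_0; ring.
      apply (is_RInt_derive (V := R_CompleteNormedModule) G g).
      - intros t _. unfold G, g. auto_derive. trivial. ring.
      - intros t _. apply (ex_derive_continuous (V := R_NormedModule)). unfold g. auto_derive. trivial. }
    assert (C2 : Cmod (a, b) * Cmod (a, b) = a * a + b * b).
    { generalize (Cmod2_alt (a, b)). simpl. lra. }
    assert (LE := is_RInt_le _ _ 0 (2 * PI) _ _ ltac:(generalize PI_RGT_0; lra) MV MG).
    assert (L : 2 * PI * Re (F p) <= 2 * PI * (v p - eps * (a * a + b * b + s * s))).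
    { apply LE. intros t _. unfold g.
      set (z := (p + polar s t)%C).
      assert (Ez : (z - p)%C = polar s t) by (unfold z; ring).
      assert (Cz : Cmod (z - p) = s).
      { rewrite Ez. unfold polar, Cmod; simpl.
        replace (_ + _) with (s * s * ((sin t)² + (cos t)²)) by (unfold Rsqr; ring).
        rewrite sin2_cos2, Rmult_1_r. apply sqrt_square. lra. }
      assert (Vz := Hv z (In z ltac:(rewrite Cz; unfold s; lra))).
      assert (Ezc : (z - c)%C = ((a + s * cos t, b + s * sin t) : C)).
      { replace (z - c)%C with ((p - c) + polar s t)%C by (unfold z; ring). rewrite Epc. reflexivity. }
      unfold v at 1 in Vz. rewrite Ezc in Vz.
      assert (C3 := Cmod2_alt (a + s * cos t, b + s * sin t)). simpl in C3. rewrite !Rmult_1_r in C3.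
      rewrite C3 in Vz. assert (T := sin2_cos2 t). unfold Rsqr in T.
      replace ((a + s * cos t) * (a + s * cos t) + (b + s * sin t) * (b + s * sin t)) with
        (a * a + b * b + s * s * (sin t * sin t + cos t * cos t) + 2 * s * (a * cos t + b * sin t)) in Vz by ring.
      rewrite T, Rmult_1_r in Vz. lra. }
    apply Rmult_le_reg_l in L. 2: generalize PI_RGT_0; lra.
    unfold v in L. rewrite Epc, C2 in L.
    assert (0 < eps * (s * s)) by (apply Rmult_lt_0_compat; [auto | apply Rmult_lt_0_compat; auto]).
    lra.
Qed.

(** Rotating by the unimodular [u] with [u * F z0 = Cmod (F z0)] reduces the modulus to a real part.
    If [F z0 = 0], a boundary point shows [0 <= M]. *)
Lemma max_principle (F : C -> C) (c q : C) (r M : R) :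
  (forall z, Cmod (z - c) <= r -> ccont F z) ->
  (forall z, Cmod (z - c) <= r -> z <> q -> cdiff F z) ->
  (forall z, Cmod (z - c) = r -> Cmod (F z) <= M) ->
  forall z, Cmod (z - c) <= r -> Cmod (F z) <= M.
Proof.
intros Hc Hd HM z0 Hz0.
destruct (classic (F z0 = 0%C)) as [E|N].
- assert (Hr : 0 <= r) by (generalize (Cmod_ge_0 (z0 - c)); lra).
  rewrite E, Cmod_0. eapply Rle_trans. apply Cmod_ge_0. apply (HM (c + r)%C).
  replace (c + r - c)%C with (RtoC r) by ring. rewrite Cmod_R. now apply Rabs_pos_eq.
- assert (P := proj1 (Cmod_gt_0 _) N). set (m := Cmod (F z0)) in *.
  set (u := (Cconj (F z0) / m)%C).
  assert (Nm : RtoC m <> 0%C) by (intros E; apply RtoC_inj in E; lra).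
  assert (Hu : Cmod u = 1).
  { unfold u. rewrite Cmod_div, Cmod_conj, Cmod_R, Rabs_pos_eq by (auto; lra). fold m. field. lra. }
  assert (Eu : (u * F z0)%C = m).
  { unfold u. replace (Cconj (F z0) / m * F z0)%C with ((F z0 * Cconj (F z0)) / m)%C by (field; auto).
    rewrite <- Cmod2_conj. fold m. rewrite RtoC_pow. field. auto. }
  replace m with (Re (u * F z0)%C) by now rewrite Eu.
  apply (max_principle_Re (fun z => u * F z)%C c q r M); auto.
  + intros z Hz. apply ccont_mult. apply ccont_const. auto.
  + intros z Hz Hq. apply cdiff_mult. apply cdiff_const. auto.
  + intros z Hz. eapply Rle_trans. apply Rle_abs. eapply Rle_trans. apply re_le_Cmod.
    rewrite Cmod_mult, Hu, Rmult_1_l. auto.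
Qed.

(** * Removable sets and the squeezing function *)

Lemma ccont_Cmod_lower (F : C -> C) (p : C) : ccont F p ->
  forall eps, 0 < eps -> exists d, 0 < d /\
    forall x, Cmod (x - p) < d -> Cmod (F p) - eps < Cmod (F x).
Proof.
intros H e He. destruct (H e He) as [d [Hd Hl]]. exists d. split; auto.
intros x Hx. generalize (Hl x Hx) (Cmod_sub_lower (F p) (F x)). rewrite Cmod_sub_sym. lra.
Qed.

(** Let [m > 0] be the minimum of [|F z - F x|] on the circle. If a [y] within [m / 2] of [F x] were
    omitted, [1 / (F - y)] would be at most [2 / m] on the circle but larger at the centre, against
    the maximum principle. *)
Lemma open_mapping (F : C -> C) (x : C) (r : R) :
  0 < r -> (forall z, Cmod (z - x) <= r -> cdiff F z) ->
  (forall z, Cmod (z - x) = r -> F z <> F x) ->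
  exists d, 0 < d /\ forall y, Cmod (y - F x) < d ->
    exists z, Cmod (z - x) <= r /\ F z = y.
Proof.
intros Hr HF Hn.
destruct (compact_min (fun z => Cmod (z - x) = r) (fun z => Cmod (F z - F x))) as [p [Hp Hmin]].
- apply compact_circle.
- exists (x + r)%C. replace (x + r - x)%C with (RtoC r) by ring.
  rewrite Cmod_R. apply Rabs_pos_eq. lra.
- intros z Hz e He.
  destruct (ccont_Cmod_lower (fun z => F z - F x)%C z) with (eps := e) as [d [Hd H]]; auto.
  apply ccont_plus. apply cdiff_ccont, HF. lra. apply ccont_const.
  exists d. split; auto.
- assert (P := Cmod_sub_pos _ _ (Hn p Hp)). set (m := Cmod (F p - F x)) in *.
  exists (m / 2). split. lra. intros y Hy. apply NNPP. intros NE.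
  assert (N : forall z, Cmod (z - x) <= r -> (F z - y)%C <> 0%C).
  { intros z Hz. apply Csub_neq. intros E. apply NE. now exists z. }
  assert (Hx : Cmod (x - x) <= r) by (rewrite Cmod_self; lra).
  assert (D : forall z, Cmod (z - x) <= r -> cdiff (fun z => / (F z - y))%C z).
  { intros z Hz. apply (cdiff_inv (fun z => F z - y)%C). auto.
    apply cdiff_minus. auto. apply cdiff_const. }
  assert (B := max_principle (fun z => / (F z - y))%C x x r (/ (m / 2))
    (fun z Hz => cdiff_ccont _ _ (D z Hz)) (fun z Hz _ => D z Hz)).
  assert (Cmod (/ (F x - y)) <= / (m / 2)).
  { apply B; auto. intros z Hz. rewrite Cmod_inv by (apply N; lra).
    apply Rinv_le_contravar. lra.
    generalize (Hmin z Hz) (Cmod_sub_triangle (F z) y (F x)). lra. }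
  rewrite Cmod_inv in H by auto. rewrite (Cmod_sub_sym (F x)) in H.
  apply Rinv_le_contravar in H. 2: apply Rinv_0_lt_compat; rewrite Cmod_sub_sym; apply Cmod_gt_0; auto.
  rewrite !Rinv_inv in H. lra.
Qed.

(* If [K] contained a disc about [a], then [1 / (z - a)] would be bounded off
   [K]; its entire extension [g] makes [1 - (z - a) g z] equal to 1 at [a] and to
   0 on large circles. *)
Lemma removable_empty_interior (K : C -> Prop) (a : C) (eps : R) :
  removable K -> (forall w, K w -> open_disc 1 w) -> 0 < eps ->
  exists z, Cmod (z - a) < eps /\ ~ K z.
Proof.
intros [_ Hext] HK He. apply NNPP. intros NE.
assert (HB : forall z, Cmod (z - a) < eps -> K z).
{ intros z Hz. apply NNPP. intros N. apply NE. now exists z. }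
assert (Ka : K a) by (apply HB; rewrite Cmod_self; lra).
assert (Ha := HK a Ka). unfold open_disc in Ha.
assert (Na : forall z, ~ K z -> (z - a)%C <> 0%C).
{ intros z Hz. apply Csub_neq. now intros ->. }
destruct (Hext (fun _ => True)) with (f := fun z => (/ (z - a))%C) as [g [Hg Eg]].
- intros z _. apply filter_true.
- auto.
- intros z [_ Hz]. apply ex_derive_cdiff. apply (cdiff_inv (fun z => z - a)%C). auto.
  apply cdiff_minus. apply cdiff_id. apply cdiff_const.
- exists (/ eps). intros z [_ Hz]. rewrite Cmod_inv by auto.
  apply Rinv_le_contravar; auto. apply Rnot_lt_le. auto.
- set (G := fun z => (1 - (z - a) * g z)%C).
  assert (D : forall z, cdiff G z).
  { intros z. apply cdiff_minus. apply cdiff_const. apply cdiff_mult.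
    apply cdiff_minus. apply cdiff_id. apply cdiff_const. apply ex_derive_cdiff. now apply Hg. }
  assert (Cmod (G a) <= 0).
  { apply (max_principle G a a 3).
    - intros z _. apply cdiff_ccont, D.
    - intros z _ _. apply D.
    - intros z Hz. assert (Nz : ~ K z).
      { intros Kz. specialize (HK z Kz). unfold open_disc in HK.
        generalize (Cmod_triangle z (- a)). rewrite Cmod_opp. fold (z - a)%C. lra. }
      unfold G. rewrite Eg by now split.
      replace (1 - (z - a) * / (z - a))%C with (0 : C) by (field; auto). rewrite Cmod_0. lra.
    - rewrite Cmod_self. lra. }
  unfold G in H. replace (1 - (a - a) * g a)%C with (1 : C) in H by ring. rewrite Cmod_1 in H. lra.
Qed.

Definition moebius (z x : C) : C := ((x - z) / (1 - Cconj z * x))%C.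

Lemma moebius_denominator (z x : C) :
  Cmod z < 1 -> Cmod x < 1 -> (1 - Cconj z * x)%C <> 0%C.
Proof.
intros Hz Hx E. assert (A : Cmod (Cconj z * x) = 1).
{ replace (Cconj z * x)%C with (1 - (1 - Cconj z * x))%C by ring. rewrite E.
  replace (1 - 0)%C with (1 : C) by ring. apply Cmod_1. }
rewrite Cmod_mult, Cmod_conj in A.
generalize (Cmod_ge_0 z) (Cmod_ge_0 x). nra.
Qed.

Lemma cdiff_moebius (z x : C) : Cmod z < 1 -> Cmod x < 1 -> cdiff (moebius z) x.
Proof.
intros Hz Hx. apply cdiff_div. now apply moebius_denominator.
apply cdiff_minus. apply cdiff_id. apply cdiff_const.
apply cdiff_minus. apply cdiff_const. apply cdiff_mult. apply cdiff_const. apply cdiff_id.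
Qed.

Lemma moebius_disc (z x : C) : Cmod z < 1 -> Cmod x < 1 -> Cmod (moebius z x) < 1.
Proof.
intros Hz Hx. assert (N := moebius_denominator z x Hz Hx).
unfold moebius. rewrite Cmod_div by auto.
assert (P := proj1 (Cmod_gt_0 _) N).
apply Rmult_lt_reg_r with (1 := P). unfold Rdiv. rewrite Rmult_assoc, Rinv_l, Rmult_1_l, Rmult_1_r by lra.
assert (I : Cmod (1 - Cconj z * x) ^ 2 - Cmod (x - z) ^ 2 = (1 - Cmod z ^ 2) * (1 - Cmod x ^ 2)).
{ rewrite !Cmod2_alt. destruct z as [a b], x as [c d]. simpl. ring. }
assert (Pz := Cmod_ge_0 z). assert (Px := Cmod_ge_0 x).
assert (0 < (1 - Cmod z ^ 2) * (1 - Cmod x ^ 2)) by (apply Rmult_lt_0_compat; nra).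
apply Rnot_le_lt. intros L. assert (Pd := Cmod_ge_0 (1 - Cconj z * x)). nra.
Qed.

(** This one inverse formula provides both the injectivity of [moebius z] and, read with [- z],
    preimages under it. *)
Lemma moebius_cancel (z x : C) :
  Cmod z < 1 -> Cmod x < 1 -> moebius (- z) (moebius z x) = x.
Proof.
intros Hz Hx. assert (N := moebius_denominator z x Hz Hx).
assert (N' := moebius_denominator z z Hz Hz).
unfold moebius. replace (Cconj (- z)) with (- Cconj z)%C.
2: destruct z; unfold Cconj, Copp; simpl; reflexivity.
field. split; auto.
replace (1 - Cconj z * x - - Cconj z * (x - z))%C with (1 - Cconj z * z)%C by ring. auto.
Qed.

(* On [|x| = s], [1 - conj z x = (1 - s^2) + x (conj x - conj z)] bounds
   [1 / |moebius z x|] by [1 + (1 - s^2) / (s - |z|)], which tends to 1. *)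
Lemma schwarz_moebius (g : C -> C) (z : C) (r0 : R) :
  Cmod z < 1 -> r0 < 1 -> (forall x, Cmod x < 1 -> cdiff g x) -> g z = 0%C ->
  (forall x, r0 < Cmod x < 1 -> Cmod (g x) <= 1) ->
  forall w, Cmod w < 1 -> Cmod (g w) <= Cmod (moebius z w).
Proof.
intros Hz Hr0 Hg Hgz Hb w Hw.
destruct (Hg z Hz) as [phi [Hphi [d [Hd E]]]].
set (G := fun x => if excluded_middle_informative (x = z) then phi z else (g x / (x - z))%C).
assert (EG : forall x, g x = (G x * (x - z))%C).
{ intros x. unfold G. destruct (excluded_middle_informative (x = z)) as [->|N].
  rewrite Hgz; ring. field. now apply Csub_neq. }
(* Off [z] this is [g] divided by [moebius z]; at [z], where it is only shown continuous,
   [max_principle] takes its exceptional point. *)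
set (h := fun x => (G x * (1 - Cconj z * x))%C).
assert (Dl : forall x, cdiff (fun x => 1 - Cconj z * x)%C x).
{ intros x. apply cdiff_minus. apply cdiff_const. apply cdiff_mult. apply cdiff_const. apply cdiff_id. }
assert (Dh : forall x, Cmod x < 1 -> x <> z -> cdiff h x).
{ intros x Hx Nx. apply cdiff_mult; auto.
  apply cdiff_local with (fun x => g x / (x - z))%C (Cmod (x - z)).
  - now apply Cmod_sub_pos.
  - intros y Hy. unfold G. destruct (excluded_middle_informative (y = z)) as [->|]; auto.
    rewrite Cmod_sub_sym in Hy. lra.
  - apply cdiff_div. now apply Csub_neq. auto. apply cdiff_minus. apply cdiff_id. apply cdiff_const. }
assert (Ch : forall x, Cmod x < 1 -> ccont h x).
{ intros x Hx. destruct (classic (x = z)) as [->|Nx].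
  - apply ccont_mult. 2: now apply cdiff_ccont.
    apply ccont_local with phi d; auto. intros y Hy. unfold G.
    destruct (excluded_middle_informative (y = z)) as [->|N]; auto.
    rewrite E by auto. rewrite Hgz. field. now apply Csub_neq.
  - now apply cdiff_ccont, Dh. }
assert (Bh : Cmod (h w) <= 1).
{ apply le_epsilon. intros e He.
  (* In order: [g] is bounded on the circle of radius [s], [w] is enclosed,
     [|x - z| >= (1 - |z|) / 2] on the circle, and hence [1 - s^2 <= 2 * (1 - s) <= e * |x - z|]. *)
  assert (X : exists s, s < 1 /\ r0 < s /\ Cmod w <= s /\ (1 + Cmod z) / 2 <= s /\ 1 - e * (1 - Cmod z) / 4 <= s).
  { exists (Rmax ((r0 + 1) / 2) (Rmax (Cmod w) (Rmax ((1 + Cmod z) / 2) (1 - e * (1 - Cmod z) / 4)))).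
    assert (0 < e * (1 - Cmod z)) by (apply Rmult_lt_0_compat; lra).
    split. repeat apply Rmax_lub_lt; lra.
    split. eapply Rlt_le_trans. 2: apply Rmax_l. lra.
    split. eapply Rle_trans. 2: apply Rmax_r. apply Rmax_l.
    split; (eapply Rle_trans; [|apply Rmax_r]; eapply Rle_trans; [|apply Rmax_r]).
    apply Rmax_l. apply Rmax_r. }
  destruct X as [s [Hs1 [Hs2 [Hs3 [Hs4 Hs5]]]]].
  assert (Z : forall x : C, (x - 0)%C = x) by (intros; ring).
  apply (max_principle h 0%C z s); try (intros x; rewrite Z).
  - intros Hx. apply Ch. lra.
  - intros Hx. apply Dh. lra.
  - intros Hx. assert (Bg := Hb x ltac:(lra)).
    assert (T := Cmod_triangle (1 - s * s)%R (x * (Cconj x - Cconj z))).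
    replace (RtoC (1 - s * s)%R + x * (Cconj x - Cconj z))%C with (1 - Cconj z * x)%C in T.
    2: { rewrite RtoC_minus, RtoC_mult.
         assert (Q := Cmod2_conj x). rewrite Hx in Q. simpl in Q. rewrite Rmult_1_r, RtoC_mult in Q.
         rewrite Q. ring. }
    rewrite Cmod_mult, Cmod_R, Hx in T.
    assert (Ec : Cmod (Cconj x - Cconj z) = Cmod (x - z)).
    { rewrite <- (Cmod_conj (x - z)). f_equal. destruct x, z. unfold Cconj, Cminus, Cplus, Copp. simpl. f_equal. ring. }
    assert (Pw := Cmod_ge_0 w). assert (Pz := Cmod_ge_0 z).
    rewrite Ec, Rabs_pos_eq in T by nra.
    assert (L := Cmod_sub_lower x z). rewrite Hx in L.
    set (k := Cmod (x - z)) in *. set (D := Cmod (1 - Cconj z * x)) in *.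
    assert (Kp : (1 - Cmod z) / 2 <= k) by lra.
    assert (DK : D <= k * (1 + e)).
    { assert (1 - s * s <= e * k).
      { apply Rle_trans with (2 * (1 - s)). nra.
        apply Rle_trans with (e * ((1 - Cmod z) / 2)). lra. apply Rmult_le_compat_l; lra. }
      assert (s * k <= k) by nra. lra. }
    apply Rmult_le_reg_r with k. lra.
    replace (Cmod (h x) * k) with (Cmod (g x) * D).
    + apply Rle_trans with (1 * D). apply Rmult_le_compat_r; auto. apply Cmod_ge_0. lra.
    + unfold D, k. rewrite <- !Cmod_mult. f_equal. rewrite EG. unfold h. ring.
  - rewrite Z. exact Hs3. }
assert (N := moebius_denominator z w Hz Hw). assert (P := proj1 (Cmod_gt_0 _) N).
unfold moebius. rewrite Cmod_div by auto. apply Rmult_le_reg_r with (1 := P).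
unfold Rdiv. rewrite Rmult_assoc, Rinv_l, Rmult_1_r by lra.
replace (Cmod (g w) * Cmod (1 - Cconj z * w)) with (Cmod (h w) * Cmod (w - z)).
- rewrite <- (Rmult_1_l (Cmod (w - z))) at 2. apply Rmult_le_compat_r; auto. apply Cmod_ge_0.
- rewrite <- !Cmod_mult. f_equal. rewrite EG. unfold h. ring.
Qed.

(* A value taken at [w] in [K] and at [x] off [K] is taken, by the open mapping
   property at [x] and the density of the complement of [K] at [w], at two
   distinct points off [K]. *)
Lemma extension_avoids_image (K : C -> Prop) (f g : C -> C) (w x : C) :
  removable K -> (forall w, K w -> open_disc 1 w) ->
  open (setdiff (open_disc 1) K) ->
  holomorphic_on (setdiff (open_disc 1) K) f -> injective_on (setdiff (open_disc 1) K) f ->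
  cdiff g w -> (forall y, setdiff (open_disc 1) K y -> g y = f y) ->
  K w -> setdiff (open_disc 1) K x -> g w <> f x.
Proof.
intros HR HK HO Hf Hinj Hg Eg Kw Ox E.
assert (Nwx : w <> x) by (intros ->; now apply (proj2 Ox)).
assert (P := Cmod_sub_pos _ _ Nwx).
destruct (proj1 (open_Cmod _) HO x Ox) as [d0 [Hd0 HB]].
(* A third keeps the closed disc about [x] inside the domain and away from every point within
   [Cmod (w - x) / 2] of [w]. *)
set (r := Rmin d0 (Cmod (w - x)) / 3).
assert (Hm : 0 < Rmin d0 (Cmod (w - x))) by now apply Rmin_pos.
assert (Hm1 := Rmin_l d0 (Cmod (w - x))). assert (Hm2 := Rmin_r d0 (Cmod (w - x))).
assert (HB' : forall z, Cmod (z - x) <= r -> setdiff (open_disc 1) K z).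
{ intros z Hz. apply HB. unfold r in Hz. lra. }
destruct (open_mapping f x r) as [d [Hd HOM]].
- unfold r. lra.
- intros z Hz. now apply ex_derive_cdiff, Hf, HB'.
- intros z Hz Ez. assert (z = x) by (apply Hinj; auto; apply HB'; lra).
  subst z. rewrite Cmod_self in Hz. unfold r in Hz. lra.
- destruct (cdiff_ccont _ _ Hg d Hd) as [d1 [Hd1 H1]].
  assert (Hw := HK w Kw). unfold open_disc in Hw.
  (* The three radii place [g w'] within [d] of [f x], keep [w'] off the disc about [x], and keep
     [w'] in the unit disc. *)
  destruct (removable_empty_interior K w (Rmin d1 (Rmin (Cmod (w - x) / 2) (1 - Cmod w))) HR HK)
    as [w' [Hw' NK]].
  { repeat apply Rmin_pos; lra. }
  assert (A1 := Rlt_le_trans _ _ _ Hw' (Rmin_l _ _)).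
  assert (A := Rlt_le_trans _ _ _ Hw' (Rmin_r _ _)).
  assert (A2 := Rlt_le_trans _ _ _ A (Rmin_l _ _)).
  assert (A3 := Rlt_le_trans _ _ _ A (Rmin_r _ _)).
  assert (Ow : setdiff (open_disc 1) K w').
  { split; auto. unfold open_disc. generalize (Cmod_sub_lower w' w).  lra. }
  specialize (H1 w' A1). rewrite E, Eg in H1 by auto.
  destruct (HOM _ H1) as [y [Hy Ey]].
  assert (y = w') by (apply Hinj; auto). subst y.
  generalize (Cmod_sub_triangle w w' x). rewrite (Cmod_sub_sym w w'). unfold r in Hy. lra.
Qed.

Lemma disc_embedding_le (K : C -> Prop) (f : C -> C) (z w : C) (r : R) :
  removable K -> (forall w, K w -> open_disc 1 w) ->
  open (setdiff (open_disc 1) K) -> setdiff (open_disc 1) K z ->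
  disc_embedding (setdiff (open_disc 1) K) z f -> K w ->
  (forall y, open_disc r y -> image_of (setdiff (open_disc 1) K) f y) ->
  r <= Cmod (moebius z w).
Proof.
intros HR HK HO Oz [Hf [Hinj [Hdisc Hfz]]] Kw Himg.
destruct (proj2 HR (open_disc 1)) with (f := f) as [g [Hg Eg]]; auto.
- apply open_Cmod. unfold open_disc. intros x Hx. exists (1 - Cmod x). split. lra.
  intros y Hy. generalize (Cmod_sub_lower y x). lra.
- exists 1. intros x Hx. left. exact (Hdisc x Hx).
- assert (Dg : forall x, Cmod x < 1 -> cdiff g x) by (intros x Hx; now apply ex_derive_cdiff, Hg).
  apply Rnot_lt_le. intros L.
  (* [k] is a point of [K] of largest modulus. The annulus beyond it is free of [K], so [g = f]
     there and the bound required by [schwarz_moebius] holds. *)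
  destruct (compact_min K (fun x => - Cmod x)) as [k [Hk Hmax]].
  { apply HR. } { now exists w. }
  { intros x _ e He. exists e. split; auto. intros y _ Hy. generalize (Cmod_sub_lower y x). lra. }
  assert (S : Cmod (g w) <= Cmod (moebius z w)).
  { apply schwarz_moebius with (r0 := Cmod k); auto.
    - apply (proj1 Oz).
    - now apply HK.
    - now rewrite Eg.
    - intros x Hx. assert (Ox : setdiff (open_disc 1) K x).
      { split. apply Hx. intros Kx. generalize (Hmax x Kx). lra. }
      rewrite Eg by auto. left. now apply Hdisc.
    - now apply HK. }
  destruct (Himg (g w)) as [x [Ox Ex]]. unfold open_disc. lra.
  apply (extension_avoids_image K f g w x); auto. apply Dg. now apply HK.
Qed.

Lemma disc_embedding_moebius (G : C -> Prop) (z : C) :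
  (forall x, G x -> open_disc 1 x) -> Cmod z < 1 -> disc_embedding G z (moebius z).
Proof.
intros HG Hz. repeat split.
- intros x Hx. apply ex_derive_cdiff. apply cdiff_moebius; auto. now apply HG.
- intros x y Hx Hy E. rewrite <- (moebius_cancel z x), <- (moebius_cancel z y); auto.
  now rewrite E. now apply HG. now apply HG.
- intros x Hx. apply moebius_disc; auto. now apply HG.
- unfold moebius, Cdiv. ring.
Qed.

Lemma moebius_image (K : C -> Prop) (z : C) (m : R) :
  Cmod z < 1 -> m <= 1 -> (forall w, K w -> m <= Cmod (moebius z w)) ->
  forall y, open_disc m y -> image_of (setdiff (open_disc 1) K) (moebius z) y.
Proof.
intros Hz Hm HK y Hy. unfold open_disc in Hy.
assert (Hz' : Cmod (- z) < 1) by now rewrite Cmod_opp.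
assert (E : moebius z (moebius (- z) y) = y).
{ replace z with (- - z)%C at 1 by ring. apply moebius_cancel; auto. lra. }
exists (moebius (- z) y). split; auto. split.
- apply moebius_disc; auto. lra.
- intros Ky. generalize (HK _ Ky). rewrite E. lra.
Qed.

Local Open Scope C_scope.

Theorem theorem1p7 :
  forall K : C -> Prop,
    (exists w, K w) ->
    (forall w, K w -> open_disc 1 w) ->
    removable K ->
    open (setdiff (open_disc 1) K) ->
    connected_set (setdiff (open_disc 1) K) ->
    forall z : C, setdiff (open_disc 1) K z ->
    exists m : R,
      squeezing (setdiff (open_disc 1) K) z = Finite m /\
      is_min_over K (fun w => Cmod ((w - z) / (1 - Cconj z * w))) m.
Proof.
intros K Kne HK HR HO _ z Oz.
assert (Hz : (Cmod z < 1)%R) by apply (proj1 Oz).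
destruct (compact_min K (fun w => Cmod (moebius z w)) (proj1 HR) Kne) as [w [Kw Hmin]].
{ intros x Kx e He.
  destruct (ccont_Cmod_lower (moebius z) x) with (eps := e) as [d [Hd H]]; auto.
  now apply cdiff_ccont, cdiff_moebius, HK. exists d. split; auto. }
exists (Cmod (moebius z w)). split.
2: split; [now exists w | exact Hmin].
apply Rbar_is_lub_unique. split.
- intros s [f [Hf ->]].
  apply (proj2 (Lub_Rbar_correct _)). intros r [_ Hr].
  apply (disc_embedding_le K f); auto.
- intros b Hb. apply Rbar_le_trans with (squeezing_at (setdiff (open_disc 1) K) (moebius z)).
  + apply (proj1 (Lub_Rbar_correct _)). split.
    (* [squeezing_at] admits only positive radii; the minimum is positive because [w] lies in [K]
       and [z] does not. *)
    * assert (N := moebius_denominator z w Hz (HK w Kw)).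
      unfold moebius. rewrite Cmod_div by exact N. apply Rdiv_lt_0_compat.
      apply Cmod_sub_pos. intros ->. now apply (proj2 Oz). now apply Cmod_gt_0.
    * apply moebius_image; auto. left. apply moebius_disc; auto. now apply HK.
  + apply Hb. exists (moebius z). split; auto.
    apply disc_embedding_moebius; auto. now intros x [Hx _].
Qed.
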